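(* Let $\mathcal{P}$ be a convex class of probability densities on some common domain, let $p_0\in\mathcal{P}$, and let $X_1,\dots,X_n$ be i.i.d. with density $p_0$. Let $P_0$ be the probability measure with density $p_0$ and $P_n$ the empirical distribution of $X_1,\dots,X_n$. Assume that a maximum likelihood estimator $$\hat p_n\in \mathop{\rm argmax}_{p\in\mathcal{P}}\frac1n\sum_{i=1}^n\log p(X_i)$$ exists. For $t\ge 0$ let $$G(t):=\sup_{p\in\mathcal{P}:\,h(p_0,p)\le t}\int\frac{4p_0}{p_0+p}\,d(P_0-P_n).$$ Suppose there exist real numbers $t_0>0$ and $0<\eta\le 1$, and a function $\bar G:[0,\infty)\to[0,\infty)$ such that 1. $\mathbb{E}G(t)\le\bar G(t)$ for every $t\ge t_0$, 2. $\bar G(t_0)\le t_0^2$, and 3. $t\mapsto \bar G(t)/t^{2-\eta}$ is non-increasing on $[t_0,\infty)$. Then $$\mathbb{P}\{h(\hat p_n,p_0)\ge t_0+x\}\le\exp\left(\frac{-n\eta^2x^2}{32}\right)\quad\text{for every }x>0,$$ and $$\mathbb{E}h^2(\hat p_n,p_0)\le 2t_0^2+\frac{32}{n\eta^2}.$$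
   Context: The Hellinger distance $h$ between densities $p,q$ is defined by $h^2(p,q):=\int(\sqrt p-\sqrt q)^2$. All expectations and probabilities are with respect to $X_1,\dots,X_n$ i.i.d. from $P_0$. *)

(* Defs.v *)
From HB Require Import structures.
From mathcomp Require Import all_boot all_order all_algebra.
From mathcomp Require Import all_classical all_reals all_analysis.

Set Implicit Arguments.
Unset Strict Implicit.
Unset Printing Implicit Defensive.

Import Order.TTheory GRing.Theory Num.Theory.
Import numFieldNormedType.Exports.

Local Open Scope classical_set_scope.
Local Open Scope ring_scope.

Section densities.
Context d (T : measurableType d) (R : realType).
Variable mu : {measure set T -> \bar R}.

Definition is_density (p : T -> R) : Prop :=
  [/\ measurable_fun [set: T] p, (forall y, 0 <= p y)
    & (\int[mu]_y (p y)%:E = 1)%E].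

(* Densities are functions rather than classes of a.e. equal functions: the
   likelihood below depends on their values at the sample points. *)
Definition convex_density_class (F : set (T -> R)) : Prop :=
  (forall p, F p -> is_density p) /\
  @convex_set R (T -> R^o : lmodType R) F.

Definition has_density (P0 : set T -> \bar R) (p0 : T -> R) : Prop :=
  forall A, measurable A -> P0 A = (\int[mu]_(y in A) (p0 y)%:E)%E.

Definition hellinger (p q : T -> R) : R :=
  Num.sqrt (\int[mu]_y (Num.sqrt (p y) - Num.sqrt (q y)) ^+ 2).

End densities.

Section samples.
Context d (T : measurableType d) (R : realType).

Section sample.
Variables (n : nat) (x : n.-tuple T).

(* [msum] takes a sequence of measures indexed by [nat]; only the indices
   [k < n], for which [insub k] is [Some _], contribute. *)
Definition empirical : {measure set T -> \bar R} :=
  mscale (n%:R^-1)%:nng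
    (msum (fun k => oapp (fun i : 'I_n => \d_(tnth x i) : {measure set T -> \bar R})
                         mzero (insub k)) n).

Lemma empiricalE (A : set T) :
  empirical A = ((n%:R^-1)%:E * \sum_(i < n) \d_(tnth x i) A)%E.
Proof.
rewrite /empirical /= /mscale /= /msum; congr (_ * _)%E.
by apply: eq_bigr => i _; rewrite valK.
Qed.

(* [lne] is the extended logarithm, with [lne 0 = -oo]. *)
Definition log_likelihood (p : T -> R) : \bar R :=
  ((n%:R^-1)%:E * \sum_(i < n) lne (p (tnth x i))%:E)%E.

Definition is_mle (F : set (T -> R)) (phat : T -> R) : Prop :=
  F phat /\ forall p, F p -> (log_likelihood p <= log_likelihood phat)%E.

End sample.

(* The quotient is 0 where [p0] and [p] both vanish. *)
Definition likelihood_ratio (p0 p : T -> R) (y : T) : R :=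
  4 * p0 y / (p0 y + p y).

(* The integrands take values in [0, 4], so all the integrals below are finite
   and, for [p0] in [F] and [0 <= t], [sup] is a genuine supremum. *)
Definition local_sup (mu P0 : {measure set T -> \bar R})
    (F : set (T -> R)) (p0 : T -> R) (t : R) (n : nat) (x : n.-tuple T) : R :=
  sup [set \int[P0]_y likelihood_ratio p0 p y
           - \int[empirical x]_y likelihood_ratio p0 p y
      | p in [set p | F p /\ hellinger mu p0 p <= t]].

End samples.

Section independence.
Context d d' (Omega : measurableType d) (T : measurableType d') (R : realType).
Variable Pr : probability Omega R.

Definition mutually_independent (I : finType) (X : I -> Omega -> T) : Prop :=
  forall (J : {set I}) (A : I -> set T), (forall i, measurable (A i)) ->
    (Pr (\bigcap_(i in [set` J]) (X i @^-1` A i)) =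
     \prod_(i in J) Pr (X i @^-1` A i))%E.

Definition iid (P0 : set T -> \bar R) (I : finType)
    (X : I -> {RV Pr >-> T}) : Prop :=
  mutually_independent (fun i => X i : Omega -> T) /\
  forall i A, measurable A -> distribution Pr (X i) A = P0 A.

End independence.

(* Main.v *)
From HB Require Import structures.
Require Import Defs.
From mathcomp Require Import all_boot all_order all_algebra.
From mathcomp Require Import all_classical all_reals all_analysis.
From mathcomp Require Import measurable_realfun ring lra.

Set Implicit Arguments.
Unset Strict Implicit.
Unset Printing Implicit Defensive.

Import Order.TTheory GRing.Theory Num.Theory.
Import numFieldNormedType.Exports.

Local Open Scope classical_set_scope.
Local Open Scope ring_scope.

(** Write [h] for the Hellinger distance, [hhat] for the loss of the maximum
likelihood estimator [phat], and [G s] for the local supremum.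

Geometry. Suppose that [hhat >= s]. The densities [a phat + (1 - a) p0] belong
to the class by convexity, and their squared distance to [p0] is continuous in
[a], so one of them, [q], is at distance exactly [s] from [p0]
([exists_segment_at]). The estimator is at least as likely as the midpoint of
[p0] and [q]; since [ln] lies below its tangents, this says that the empirical
mean of [4 p0 / (p0 + q)] is at most 2 ([mle_ratio_sum]). Its mean under [P0]
is at least [2 + s^2] ([mean_ratio_ge]), whence [G s >= s^2]
([mle_local_sup]). On the other hand the growth condition on the envelope gives
[E (G s) <= s^2 (t0 / s)^eta] ([envelope_growth]). So [hhat >= s] forces [G s] to
exceed its mean by at least the fraction [1 - (t0 / s)^eta] of [s^2].

Concentration. Upper deviations of [G s] are bounded by the entropy method. The
entropy of [expR (l Z)], where [Z = n (G s)], is at most the sum of its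
conditional entropies, one for each observation ([entropy_subadditive]); each of
these is controlled by comparing [Z] with the supremum in which that
observation is left out ([site_entropy], [entropy_sup]); Herbst's argument turns
the resulting differential inequality into a bound on the logarithmic moment
generating function ([herbst]), and Chernoff's method into a tail
([subgamma_tail]). The variance of [4 p0 / (p0 + p)] is of order [h^2]
([mean_ratio_variance]), which makes the exponent of order [n s^2]. With
explicit constants the outcome is ([hellinger_tail])

  P (hhat >= t0 + x) <=
    exp (- n eta^2 x^2 / (99/5 - 5 x / (t0 + x))),

and the denominator is at most 32.

Second moment. Integrating the tail [exp (- n eta^2 x^2 / 32)] does not suffice:
the cross term [2 t0 x] contributes a multiple of [t0 / sqrt (n eta^2)], which
exceeds [t0^2] when [t0] is small. The sharper tail leaves the room needed: after
rescaling, the second moment is bounded by Gaussian integrals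
([second_moment_layer_cake], [tail_le_gaussian]), the cross term is split by the
inequality between arithmetic and geometric means, and the constants fit because
[pi <= 16/5] ([second_moment_le]). *)

(** * Elementary inequalities *)

Section exponential_inequalities.
Context {R : realType}.
Implicit Types (x y b l : R).

Lemma le_of_derive_ge0 (f df : R -> R) (a : R) :
  (forall x, is_derive x 1 f (df x)) -> (forall x, a < x -> 0 <= df x) ->
  forall x, a <= x -> f a <= f x.
Proof.
move=> fdf df0 x ax; apply: (@ger0_derive1_ndecry R f a) => //.
- move=> y; rewrite in_itv/= andbT => ay.
  by rewrite derive1E (@derive_val _ _ _ _ _ _ _ (fdf y)) df0.
- apply: continuous_subspaceT => y.
  by apply: differentiable_continuous; apply/derivable1_diffP; exact: ex_derive.
Qed.

Lemma expR_ge_quadratic y : 0 <= y -> 1 + y + y ^+ 2 / 2 <= expR y.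
Proof.
move=> y0; rewrite -subr_ge0.
pose g (t : R) : R := expR t - (1 + t + t ^+ 2 / 2).
have g0 : g 0 = 0 by rewrite /g expR0; ring.
rewrite -[X in X <= _]g0 -[X in _ <= X]/(g y).
apply: (@le_of_derive_ge0 g (fun t => expR t - (1 + t))) y0.
- move=> t; rewrite /g; apply: is_derive_eq.
  by rewrite /GRing.scale/=; field.
- by move=> t _; rewrite subr_ge0 expR_ge1Dx.
Qed.

Lemma expR_ge_cubic y :
  0 <= y -> 1 + y + y ^+ 2 / 2 + y ^+ 3 / 6 <= expR y.
Proof.
move=> y0; rewrite -subr_ge0.
pose g (t : R) : R := expR t - (1 + t + t ^+ 2 / 2 + t ^+ 3 / 6).
have g0 : g 0 = 0 by rewrite /g expR0; ring.
rewrite -[X in X <= _]g0 -[X in _ <= X]/(g y).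
apply: (@le_of_derive_ge0 g (fun t => expR t - (1 + t + t ^+ 2 / 2))) y0.
- move=> t; rewrite /g; apply: is_derive_eq.
  by rewrite /GRing.scale/=; field.
- by move=> t /ltW t0; rewrite subr_ge0 expR_ge_quadratic.
Qed.

Lemma expRN_ge_quadratic y : 0 <= y -> 1 - y ^+ 2 / 2 <= expR (- y) * (1 + y).
Proof.
move=> y0; rewrite -subr_ge0.
pose g (t : R) : R := expR (- t) * (1 + t) - (1 - t ^+ 2 / 2).
have g0 : g 0 = 0 by rewrite /g oppr0 expR0; ring.
rewrite -[X in X <= _]g0 -[X in _ <= X]/(g y).
apply: (@le_of_derive_ge0 g (fun t => t * (1 - expR (- t)))) y0.
- move=> t; rewrite /g; apply: is_derive_eq.
  by rewrite /GRing.scale/=; field.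
- by move=> t t0; rewrite mulr_ge0 ?(ltW t0)// subr_ge0 -[leRHS]expR0 ler_expR; lra.
Qed.

(** The difference of the two sides is affine in [b], with slope
[y (1 - exp (-y)) - (exp (-y) - 1 + y) / 2 >= 0]. It is therefore enough to
treat the smallest admissible [b]: [y / 2] for [y >= 0], and [0] otherwise. *)
Lemma phi_bound y b : 0 <= b -> y <= 2 * b ->
  (1 + b / 2) * (expR (- y) - 1 + y) <=
  y ^+ 2 / 2 * expR (- y) + b * (y * (1 - expR (- y))).
Proof.
move=> b0 yb.
have coef : 0 <= y * (1 - expR (- y)) - (expR (- y) - 1 + y) / 2.
  have h : 2 * y + 1 <= expR y * (y + 1).
    have e1 := expR_ge1Dx y.
    have [y0|y0] := leP 0 (1 + y); first by nra.
    have : expR y <= 1 by rewrite -expR0 ler_expR; lra.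
    by have := expR_gt0 y; nra.
  have E : expR y * expR (- y) = 1 by rewrite expRxMexpNx_1.
  have : expR (- y) * (2 * y + 1) <= expR (- y) * (expR y * (y + 1)).
    by rewrite ler_pM2l ?expR_gt0.
  by rewrite mulrA [expR (- y) * expR y]mulrC E; lra.
have [y0|/ltW y0] := leP 0 y.
  have H : expR (- y) - 1 + y - y ^+ 2 / 2 * expR (- y) <=
      (y / 2) * (y * (1 - expR (- y)) - (expR (- y) - 1 + y) / 2).
    have E : expR y * expR (- y) = 1 by rewrite expRxMexpNx_1.
    have h : 4 + y <= (y ^+ 2 - 3 * y + 4) * expR y.
      have c := expR_ge_cubic y0.
      have q : 0 < y ^+ 2 - 3 * y + 4 by have := sqr_ge0 (y - 3/2); nra.
      apply: le_trans (_ : (y ^+ 2 - 3 * y + 4) *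
        (1 + y + y ^+ 2 / 2 + y ^+ 3 / 6) <= _); last by rewrite ler_pM2l.
      have -> : (y ^+ 2 - 3 * y + 4) * (1 + y + y ^+ 2 / 2 + y ^+ 3 / 6) =
        4 + y + (y ^+ 3 + y ^+ 5) / 6 by field.
      by rewrite lerDl divr_ge0// addr_ge0// exprn_ge0.
    have : expR (- y) * (4 + y) <= expR (- y) * ((y ^+ 2 - 3 * y + 4) * expR y).
      by rewrite ler_pM2l ?expR_gt0.
    have -> : expR (- y) * ((y ^+ 2 - 3 * y + 4) * expR y) =
       (y ^+ 2 - 3 * y + 4) * (expR y * expR (- y)) by ring.
    by rewrite E; nra.
  have H2 : (y / 2) * (y * (1 - expR (- y)) - (expR (- y) - 1 + y) / 2) <=
            b * (y * (1 - expR (- y)) - (expR (- y) - 1 + y) / 2).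
    by rewrite ler_wpM2r//; lra.
  by lra.
have H : expR (- y) - 1 + y - y ^+ 2 / 2 * expR (- y) <= 0.
  have h : 1 - (- y) ^+ 2 / 2 <= expR (- - y) * (1 + - y).
    by apply: expRN_ge_quadratic; lra.
  have E : expR y * expR (- y) = 1 by rewrite expRxMexpNx_1.
  have : expR (- y) * (1 - (- y) ^+ 2 / 2) <= expR (- y) * (expR (- - y) * (1 + - y)).
    by rewrite ler_pM2l ?expR_gt0.
  rewrite opprK mulrA [expR (- y) * expR y]mulrC E sqrrN; lra.
have := mulr_ge0 b0 coef; lra.
Qed.

Lemma ln_le_sub1 x : 0 < x -> ln x <= x - 1.
Proof.
move=> x0; have -> : ln x = ln (1 + (x - 1)) by congr ln; ring.
by apply: le_ln1Dx; lra.
Qed.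

(** Concavity of [ln] between [z] and [1], through its tangent at the barycenter
[1 - a (1 - z)]. *)
Lemma powR_le_bernoulli (z a : R) : 0 < z -> 0 <= a -> a <= 1 ->
  z `^ a <= 1 - a * (1 - z).
Proof.
move=> z0 a0 a1.
have c0 : 0 < 1 - a * (1 - z) by nra.
rewrite /powR gt_eqF//.
have -> : 1 - a * (1 - z) = expR (ln (1 - a * (1 - z))) by rewrite lnK// posrE.
rewrite ler_expR.
set c := 1 - a * (1 - z) in c0 *.
have h1 : ln (z / c) <= z / c - 1.
  by apply: ln_le_sub1; rewrite divr_gt0.
have h2 : ln (1 / c) <= 1 / c - 1.
  by apply: ln_le_sub1; rewrite divr_gt0.
rewrite ln_div ?posrE// in h1; rewrite ln_div ?posrE// ln1 in h2.
have E : a * (z / c - 1) + (1 - a) * (1 / c - 1) = 0.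
  have -> : a * (z / c - 1) + (1 - a) * (1 / c - 1) = (a * z + (1 - a)) / c - 1 by field; rewrite gt_eqF.
  have -> : a * z + (1 - a) = c by rewrite /c; ring.
  by rewrite divff ?subrr// gt_eqF.
nra.
Qed.

(** Squaring Bernoulli's inequality for the square root of [z] retains a gain of
second order in [1 - z]; [exponent_comparison] depends on this gain. *)
Lemma powR_le_bernoulli2 (z a : R) : 0 < z -> z <= 1 -> 0 <= a -> a <= 1 ->
  a * (1 - z) * (1 + (1 - a) * (1 - z) / 4) <= 1 - z `^ a.
Proof.
move=> z0 z1 a0 a1.
set w := Num.sqrt z.
have w0 : 0 < w by rewrite sqrtr_gt0.
have wz : w ^+ 2 = z by rewrite sqr_sqrtr ?ltW.
have w1 : w <= 1 by rewrite -sqrtr1 ler_wsqrtr.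
have -> : z `^ a = (w `^ a) ^+ 2.
  by rewrite expr2 -powRM ?(ltW w0)// -expr2 wz.
have b := powR_le_bernoulli w0 a0 a1.
have p0 : 0 <= w `^ a by exact: powR_ge0.
have c0 : 0 <= 1 - a * (1 - w) by nra.
have : (w `^ a) ^+ 2 <= (1 - a * (1 - w)) ^+ 2 by rewrite ler_sqr ?nnegrE.
rewrite -wz; set d := 1 - w; have -> : w = 1 - d by rewrite /d; ring.
have d0 : 0 <= d by rewrite /d; lra.
have d1 : d <= 1 by rewrite /d; lra.
move=> H; suff : a * (1 - (1 - d) ^+ 2) * (1 + (1 - a) * (1 - (1 - d) ^+ 2) / 4) <=
   1 - (1 - a * d) ^+ 2 by lra.
have -> : 1 - (1 - a * d) ^+ 2 = a * d * (2 - a * d) by ring.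
have -> : 1 - (1 - d) ^+ 2 = d * (2 - d) by ring.
have -> : a * (d * (2 - d)) * (1 + (1 - a) * (d * (2 - d)) / 4) =
  a * d * ((2 - d) * (1 + (1 - a) * (d * (2 - d)) / 4)) by ring.
apply: ler_wpM2l; first by rewrite mulr_ge0.
have : (2 - d) * (d * (2 - d)) <= 4 * d by nra.
nra.
Qed.
End exponential_inequalities.

(** * Means of bounded measurable functions *)

Section bounded_measurable.
Context {d} {T : measurableType d} {R : realType}.
Implicit Types (f g : T -> R) (c : R).

(** On a probability space these functions are integrable, and they form an algebra
stable under [expR]; this discharges all integrability conditions below. *)
Definition bmeas f :=
  measurable_fun [set: T] f /\ exists M, forall x, `|f x| <= M.

Lemma bmeas_cst c : bmeas (fun=> c).
Proof. by split; [exact: measurable_cst|exists `|c|]. Qed.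

Lemma bmeasD f g : bmeas f -> bmeas g -> bmeas (fun x => f x + g x).
Proof.
move=> [mf [M fM]] [mg [N gN]]; split; first exact: measurable_funD.
by exists (M + N) => x; rewrite (le_trans (ler_normD _ _))// lerD.
Qed.

Lemma bmeasN f : bmeas f -> bmeas (fun x => - f x).
Proof.
move=> [mf [M fM]]; split; first exact: measurableT_comp.
by exists M => x; rewrite normrN.
Qed.

Lemma bmeasM f g : bmeas f -> bmeas g -> bmeas (fun x => f x * g x).
Proof.
move=> [mf [M fM]] [mg [N gN]]; split; first exact: measurable_funM.
by exists (M * N) => x; rewrite normrM ler_pM.
Qed.

Lemma bmeas_expR f : bmeas f -> bmeas (fun x => expR (f x)).
Proof.
move=> [mf [M fM]]; split; first exact: measurableT_comp.
exists (expR M) => x; rewrite ger0_norm ?expR_ge0// ler_expR.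
by rewrite (le_trans _ (fM x))// ler_norm.
Qed.

Lemma bmeasX f n : bmeas f -> bmeas (fun x => f x ^+ n).
Proof.
elim: n => [|n IH] bf.
  by under eq_fun do rewrite expr0; exact: bmeas_cst.
under eq_fun do rewrite exprS.
by apply: bmeasM => //; exact: IH.
Qed.

Lemma bmeas_sum (I : Type) (s : seq I) (F : I -> T -> R) :
  (forall i, bmeas (F i)) -> bmeas (fun x => \sum_(i <- s) F i x).
Proof.
move=> bF; elim: s => [|i s IH].
  by under eq_fun do rewrite big_nil; exact: bmeas_cst.
by under eq_fun do rewrite big_cons; exact: bmeasD.
Qed.

Lemma bmeas_ln f c : 0 < c -> (forall x, c <= f x) -> bmeas f ->
  bmeas (fun x => ln (f x)).
Proof.
move=> c0 cf [mf [M fM]]; split.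
  exact: (measurableT_comp (@measurable_ln R) mf).
exists (`|ln c| + `|M|) => x.
have f0 : 0 < f x := lt_le_trans c0 (cf x).
have h1 : ln c <= ln (f x) by rewrite ler_ln ?posrE.
have h2 : ln (f x) <= M.
  by rewrite (le_trans (ltW (ln_sublinear f0)))// (le_trans (ler_norm _)).
rewrite ler_norml; have := ler_norm M; have := ler_norm (- ln c).
rewrite normrN; have := normr_ge0 M; have := normr_ge0 (ln c); lra.
Qed.

Lemma measurable_inv_pos f : measurable_fun [set: T] f -> (forall x, 0 <= f x) ->
  measurable_fun [set: T] (fun x => (f x)^-1).
Proof.
move=> mf f0.
under eq_fun do rewrite -powR_inv1//.
exact: (measurableT_comp (@measurable_powR R (-1)) mf).
Qed.

Lemma bmeas_inv f c : 0 < c -> (forall x, c <= f x) -> bmeas f ->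
  bmeas (fun x => (f x)^-1).
Proof.
move=> c0 cf [mf _]; split.
  by apply: measurable_inv_pos => // x; rewrite (le_trans (ltW c0)).
exists c^-1 => x; have f0 : 0 < f x := lt_le_trans c0 (cf x).
by rewrite ger0_norm ?invr_ge0 ?(ltW f0)// lef_pV2 ?posrE.
Qed.

Variable P : probability T R.

Lemma bmeas_integrable f : bmeas f -> P.-integrable [set: T] (EFin \o f).
Proof.
move=> [mf [M fM]]; apply: measurable_bounded_integrable => //.
  by rewrite /= probability_setT ltry.
exists M; split; rewrite ?num_real// => y My x _ /=.
exact: le_trans (fM x) (ltW My).
Qed.

Lemma mean_cst c : \int[P]_x c = c.
Proof. by rewrite Rintegral_cst//= probability_setT mulr1. Qed.

Lemma meanD f g : bmeas f -> bmeas g ->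
  \int[P]_x (f x + g x) = \int[P]_x f x + \int[P]_x g x.
Proof. by move=> bf bg; apply: RintegralD => //; exact: bmeas_integrable. Qed.

Lemma meanB f g : bmeas f -> bmeas g ->
  \int[P]_x (f x - g x) = \int[P]_x f x - \int[P]_x g x.
Proof. by move=> bf bg; apply: RintegralB => //; exact: bmeas_integrable. Qed.

Lemma meanZ f c : bmeas f -> \int[P]_x (c * f x) = c * \int[P]_x f x.
Proof. by move=> bf; apply: RintegralZl => //; exact: bmeas_integrable. Qed.

Lemma meanN f : bmeas f -> \int[P]_x (- f x) = - \int[P]_x f x.
Proof.
by move=> bf; under eq_Rintegral do rewrite -mulN1r; rewrite meanZ// mulN1r.
Qed.

Lemma le_mean f g : bmeas f -> bmeas g -> (forall x, f x <= g x) ->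
  \int[P]_x f x <= \int[P]_x g x.
Proof.
by move=> bf bg fg; apply: le_Rintegral => //; exact: bmeas_integrable.
Qed.

Lemma mean_sum (I : Type) (s : seq I) (F : I -> T -> R) :
  (forall i, bmeas (F i)) ->
  \int[P]_x (\sum_(i <- s) F i x) = \sum_(i <- s) \int[P]_x F i x.
Proof.
move=> bF; elim: s => [|i s IH].
  by under eq_Rintegral do rewrite big_nil; rewrite mean_cst big_nil.
under eq_Rintegral do rewrite big_cons.
by rewrite meanD ?big_cons ?IH//; exact: bmeas_sum.
Qed.

Lemma mean_ge f c : bmeas f -> (forall x, c <= f x) -> c <= \int[P]_x f x.
Proof.
by move=> bf cf; rewrite -[leLHS]mean_cst le_mean//; exact: bmeas_cst.
Qed.

Lemma mean_le f c : bmeas f -> (forall x, f x <= c) -> \int[P]_x f x <= c.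
Proof.
by move=> bf cf; rewrite -[leRHS]mean_cst le_mean//; exact: bmeas_cst.
Qed.

Lemma mean_norm_le f c : (forall x, `|f x| <= c) -> bmeas f ->
  `|\int[P]_x f x| <= c.
Proof.
move=> fc bf; rewrite ler_norml mean_ge ?mean_le// => x;
  by have := fc x; rewrite ler_norml => /andP[].
Qed.

End bounded_measurable.

Ltac bmeas_tac :=
  repeat first [ assumption | exact: bmeas_cst | apply: bmeasD | apply: bmeasN
    | apply: bmeasM | apply: bmeasX | apply: bmeas_expR ].

(** * Resampling one coordinate of a sample *)

Section resampling.
Context {d} {T : measurableType d} {R : realType} {n : nat}.
Implicit Types (x : n.-tuple T) (i j : 'I_n) (y : T).

Definition upd i y x : n.-tuple T := [tuple if j == i then y else tnth x j | j < n].

Lemma tnth_upd i y x j : tnth (upd i y x) j = if j == i then y else tnth x j.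
Proof. by rewrite tnth_mktuple. Qed.

Lemma upd_upd i y y' x : upd i y (upd i y' x) = upd i y x.
Proof. by apply: eq_from_tnth => j; rewrite !tnth_upd; case: eqP. Qed.

Lemma updC i j y z x : i != j -> upd i y (upd j z x) = upd j z (upd i y x).
Proof.
move=> ij; apply: eq_from_tnth => k; rewrite !tnth_upd.
by case: (eqVneq k i) => // ->; rewrite (negbTE ij).
Qed.

Lemma measurable_upd i :
  measurable_fun [set: T * n.-tuple T] (fun z => upd i z.1 z.2).
Proof.
apply/measurable_fun_tnthP => j.
rewrite (_ : _ \o _ = fun z : T * n.-tuple T => if j == i then z.1 else tnth z.2 j).
  case: (j == i); first exact: measurable_fst.
  exact: (measurableT_comp (@measurable_tnth _ T n j) measurable_snd).
by apply/funext => z /=; rewrite tnth_upd.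
Qed.

Lemma measurable_updl i x : measurable_fun [set: T] (fun y => upd i y x).
Proof.
apply/measurable_fun_tnthP => j.
rewrite (_ : _ \o _ = fun y => if j == i then y else tnth x j).
  by case: (j == i); [exact: measurable_id|exact: measurable_cst].
by apply/funext => z /=; rewrite tnth_upd.
Qed.

Definition ignores i (f : n.-tuple T -> R) := forall y x, f (upd i y x) = f x.

Variable P : probability T R.

(** For an i.i.d. sample, the conditional expectation given the coordinates other
than [i]. *)
Definition resample i (f : n.-tuple T -> R) x := \int[P]_y f (upd i y x).

Lemma bmeas_updl i x (f : n.-tuple T -> R) : bmeas f ->
  bmeas (fun y => f (upd i y x)).
Proof.
move=> [mf [M fM]]; split; last by exists M.
exact: (measurableT_comp mf (measurable_updl i x)).
Qed.

Lemma ignores_resample i f : ignores i (resample i f).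
Proof. by move=> y x; apply: eq_Rintegral => z _; rewrite upd_upd. Qed.

Lemma ignores_resample_other i j f : ignores j f -> ignores j (resample i f).
Proof.
have [->|ij] := eqVneq i j; first by move=> _; exact: ignores_resample.
by move=> fj y x; apply: eq_Rintegral => z _; rewrite updC// fj.
Qed.

Lemma resampleM i f g : bmeas f -> ignores i g ->
  resample i (fun x => g x * f x) = fun x => g x * resample i f x.
Proof.
move=> bf fg; apply/funext => x; rewrite /resample.
under eq_Rintegral do rewrite fg.
by rewrite meanZ//; exact: bmeas_updl.
Qed.

Lemma measurable_comp_upd i (f : n.-tuple T -> R) : measurable_fun setT f ->
  measurable_fun [set: T * n.-tuple T] (fun z => f (upd i z.1 z.2)).
Proof. by move=> mf; exact: (measurableT_comp mf (measurable_upd i)). Qed.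

Variable Q : probability (n.-tuple T) R.

Lemma integrable_comp_upd i (f : n.-tuple T -> R) : bmeas f ->
  (P \x Q)%E.-integrable [set: T * n.-tuple T]
    (fun z => (f (upd i z.1 z.2))%:E).
Proof.
move=> [mf [M fM]].
apply: measurable_bounded_integrable => //.
- by rewrite -setXTT [ltLHS]product_measure1E//= !probability_setT mule1 ltry.
- exact: measurable_comp_upd.
- exists M; split; rewrite ?num_real// => y My x _ /=.
  exact: le_trans (fM _) (ltW My).
Qed.

Lemma bmeas_resample i f : bmeas f -> bmeas (resample i f).
Proof.
move=> bf; have [mf [M fM]] := bf; split; last first.
  by exists M => x; apply: mean_norm_le => //; exact: bmeas_updl.
have := measurable_fubini_G (integrable_comp_upd i bf).
move=> /= mG; apply/measurable_EFinP.
apply: eq_measurable_fun mG => x _ /=.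
rewrite /resample /Rintegral fineK//.
by apply: integrable_fin_num => //; apply: bmeas_integrable; exact: bmeas_updl.
Qed.

Definition rectangle (A : 'I_n -> set T) : set (n.-tuple T) :=
  [set x | forall i, A i (tnth x i)].

Lemma measurable_rectangle A : (forall i, measurable (A i)) ->
  measurable (rectangle A).
Proof.
move=> mA; rewrite (_ : rectangle A = \bigcap_(i in [set: 'I_n]) ((@tnth n T ^~ i) @^-1` A i)).
  apply: fin_bigcap_measurable => // i _.
  rewrite -[X in measurable X]setTI.
  exact: (@measurable_tnth _ T n i).
by apply/seteqP; split=> x /= h i; [move=> _|]; exact: h.
Qed.

(** Rectangles form a pi-system that generates the product sigma-algebra, so that
this identity determines [Q]. *)
Definition product_law := forall A : 'I_n -> set T, (forall i, measurable (A i)) ->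
  Q (rectangle A) = (\prod_(i < n) P (A i))%E.

Hypothesis QE : product_law.

(** Replacing one observation by a fresh independent one preserves the law of the
sample: the two laws agree on rectangles. *)
Lemma resample_law i (B : set (n.-tuple T)) : measurable B ->
  Q B = (P \x Q)%E [set z | B (upd i z.1 z.2)].
Proof.
pose phi (z : T * n.-tuple T) := upd i z.1 z.2.
have mphi : measurable_fun setT phi by exact: measurable_upd.
pose phi' : {mfun (T * n.-tuple T)%type >-> n.-tuple T} :=
  HB.pack phi (isMeasurableFun.Build _ _ _ _ phi mphi).
pose PQ : probability (T * n.-tuple T)%type R := (P \x Q)%E.
pose m2 : probability (n.-tuple T) R := distribution PQ phi'.
pose G := [set B | exists A : 'I_n -> set T, (forall i, measurable (A i)) /\ B = rectangle A].
move=> mB; transitivity (m2 B); last by [].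
have mGs : measurable = <<s G >>.
  rewrite eqEsubset; split.
    apply: smallest_sub; first exact: smallest_sigma_algebra.
    elim/big_ind : _ => [//|U V hU hV|j _]; first by rewrite subUset.
    move=> _ [C mC <-]; apply: sub_sigma_algebra.
    exists (fun k => if k == j then C else setT); split.
      by move=> k; case: (k == j).
    apply/seteqP; split => x /=; rewrite /rectangle/=.
      by move=> [_ Cx] k; case: eqP => // ->.
    by move=> /(_ j); rewrite eqxx.
  apply: smallest_sub; first exact: sigma_algebra_measurable.
  by move=> _ [A [mA ->]]; exact: measurable_rectangle.
apply: (measure_unique G (fun=> setT) mGs) => //.
- move=> _ _ [A [mA ->]] [C [mC ->]]; exists (fun i => A i `&` C i); split.
    by move=> k; exact: measurableI.
  apply/seteqP; split => x /=; first by move=> [h1 h2] k; split.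
  by move=> h; split => k; have [] := h k.
- move=> _; exists (fun=> setT); split => //.
  by apply/seteqP; split.
- by rewrite bigcup_const//; exists 0%N.
- move=> _ [A [mA ->]].
  rewrite [LHS]QE// /m2/= /distribution /pushforward.
  pose A' k := if k == i then setT else A k.
  have mA' k : measurable (A' k) by rewrite /A'; case: (k == i).
  rewrite (_ : phi' @^-1` _ = A i `*` rectangle A').
    rewrite [RHS]product_measure1E//; last exact: measurable_rectangle.
    rewrite [X in (_ * X)%E](QE mA').
    rewrite (bigD1 i)//= [in RHS](bigD1 i)//= /A' eqxx probability_setT mul1e.
    by congr (_ * _)%E; apply: eq_bigr => k /negbTE ->.
  apply/seteqP; split => -[y x] /=; rewrite /rectangle/= /phi/=.
    move=> h; split; first by have := h i; rewrite tnth_upd eqxx.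
    by move=> k; have := h k; rewrite /A' tnth_upd; case: eqP.
  move=> [Ay h] k; have := h k; rewrite /A' tnth_upd.
  by case: eqP => [->|].
- by move=> _; rewrite /= probability_setT ltry.
Qed.

Lemma mean_resample i f : bmeas f ->
  \int[Q]_x resample i f x = \int[Q]_x f x.
Proof.
move=> bf; have [mf _] := bf.
pose phi (z : T * n.-tuple T) := upd i z.1 z.2.
have mphi : measurable_fun setT phi by exact: measurable_upd.
pose phi' : {mfun (T * n.-tuple T)%type >-> n.-tuple T} :=
  HB.pack phi (isMeasurableFun.Build _ _ _ _ phi mphi).
pose PQ : probability (T * n.-tuple T)%type R := (P \x Q)%E.
rewrite /Rintegral; congr fine.
transitivity (\int[Q]_x \int[P]_y (f (upd i y x))%:E)%E.
  apply: eq_integral => x _; rewrite /resample /Rintegral fineK//.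
  by apply: integrable_fin_num => //; apply: bmeas_integrable; exact: bmeas_updl.
rewrite (integral21_prod_meas1 (integrable_comp_upd i bf)).
transitivity (\int[distribution PQ phi']_x (f x)%:E)%E; last first.
  apply: eq_measure_integral => A mA _.
  by rewrite [RHS](resample_law i mA).
rewrite integral_distribution//.
- exact/measurable_EFinP.
- exact: integrable_comp_upd.
Qed.

End resampling.

(** * Entropy bound for one coordinate *)

Section single_site.
Context {d} {T : measurableType d} {R : realType} (P : probability T R).

(** Here [F] is the supremum as a function of one observation, [S] the sum of a nearly
optimal member of the class over the other observations, and [S + g] its full sum.
With [Y = F - S], [phi_bound]
gives a pointwise bound whose last ingredient, the convex function
[Y^2 / 2 - b Y], is decreasing up to [b]: on the interval between [g] and [B] it
exceeds its value at [g] by at most [(B - b)^2 / 2]. The term [m ln m] is bounded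
below by the tangent inequality at [c = exp (l S)], and [c <= m] because [g] has
mean zero. *)
Lemma site_entropy (F g : T -> R) (S B b l s2 : R) :
  bmeas F -> bmeas g -> \int[P]_y g y = 0 -> \int[P]_y (g y ^+ 2) <= s2 ->
  0 <= l -> 0 < b -> b <= B -> B <= 2 * b ->
  (forall y, S + g y <= F y) -> (forall y, F y <= S + B) ->
  forall m A, m = \int[P]_y expR (l * F y) ->
  A = \int[P]_y (expR (l * F y) * F y) ->
  l * A - m * ln m <=
  l ^+ 2 / (1 + b * l / 2) * (b * (A - S * m) + (s2 + (B - b) ^+ 2) / 2 * m).
Proof.
move=> bF bg g0 gs2 l0 b0 bB B2b gF FB m A mE AE.
set c := expR (l * S).
have c0 : 0 < c by exact: expR_gt0.
set D := 1 + b * l / 2.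
have D0 : 0 < D by rewrite /D; have := mulr_ge0 (ltW b0) l0; lra.
set C := l ^+ 2 / D.
have C0 : 0 <= C by rewrite /C divr_ge0// ?sqr_ge0// ltW.
have bE : bmeas (fun y => expR (l * F y)).
  by apply: bmeas_expR; apply: bmeasM => //; exact: bmeas_cst.
have bEF : bmeas (fun y => expR (l * F y) * F y) by exact: bmeasM.
have bg2 : bmeas (fun y => g y ^+ 2) by exact: bmeasX.
have m0 : 0 < m.
  have [M FM] := bF.2.
  apply: (@lt_le_trans _ _ (expR (l * - M))); first exact: expR_gt0.
  rewrite mE; apply: mean_ge => // y; rewrite ler_expR ler_wpM2l//.
  by have := FM y; rewrite ler_norml => /andP[].
have cm : c <= m.
  have -> : c = \int[P]_y (c + (c * l) * g y).
    rewrite meanD; [|exact: bmeas_cst|by apply: bmeasM => //; exact: bmeas_cst].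
    by rewrite mean_cst meanZ// g0 mulr0 addr0.
  rewrite mE; apply: le_mean => //.
    by apply: bmeasD; [exact: bmeas_cst|apply: bmeasM => //; exact: bmeas_cst].
  move=> y; apply: (@le_trans _ _ (expR (l * (S + g y)))).
    rewrite mulrDr expRD -/c -mulrA -[X in X + _]mulr1 -mulrDr ler_pM2l//.
    exact: expR_ge1Dx.
  by rewrite ler_expR ler_wpM2l.
have pt y : l * (expR (l * F y) * F y) - (l * S + 1) * expR (l * F y) + c <=
   C * b * (expR (l * F y) * F y) - C * b * S * expR (l * F y) +
   (C * c / 2 * g y ^+ 2 - C * c * b * g y + C * c * (B - b) ^+ 2 / 2).
  set Y := F y - S.
  have H := @phi_bound R (l * Y) (b * l) _ _.
  have {H} : D * (expR (- (l * Y)) - 1 + l * Y) <=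
     (l * Y) ^+ 2 / 2 * expR (- (l * Y)) +
     b * l * (l * Y * (1 - expR (- (l * Y)))).
    apply: H; first by rewrite mulr_ge0// ltW.
    have : Y <= 2 * b by rewrite /Y; have := FB y; lra.
    by move=> h; have := ler_wpM2l l0 h; lra.
  set E := expR (l * F y); set e := expR (- (l * Y)).
  have Ee : E * e = c by rewrite -expRD; congr expR; rewrite /Y; ring.
  have E0 : 0 < E by exact: expR_gt0.
  move=> h; have {h} := ler_wpM2l (ltW E0) h.
  have -> : E * (D * (e - 1 + l * Y)) = D * (E * e - E + E * (l * Y)) by ring.
  have -> : E * ((l * Y) ^+ 2 / 2 * e + b * l * (l * Y * (1 - e))) =
     l ^+ 2 * (b * Y * E + (Y ^+ 2 / 2 - b * Y) * (E * e)) by field.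
  rewrite Ee => h.
  have {}h : c - E + E * (l * Y) <= C * (b * Y * E + (Y ^+ 2 / 2 - b * Y) * c).
    by rewrite /C mulrAC ler_pdivlMr// mulrC.
  have h2 : Y ^+ 2 / 2 - b * Y <= g y ^+ 2 / 2 - b * g y + (B - b) ^+ 2 / 2.
    have h1 : g y <= Y by rewrite /Y; have := gF y; lra.
    have h3 : Y <= B by rewrite /Y; have := FB y; lra.
    (* below [b] the parabola is decreasing; above, it is at most its value at [B] *)
    have [Yb|bY] := leP Y b.
      have := sqr_ge0 (B - b); nra.
    have := sqr_ge0 (g y - b); nra.
  have h3 : C * ((Y ^+ 2 / 2 - b * Y) * c) <=
     C * ((g y ^+ 2 / 2 - b * g y + (B - b) ^+ 2 / 2) * c).
    by apply: ler_wpM2l => //; apply: ler_wpM2r => //; exact: ltW.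
  have -> : l * (E * F y) - (l * S + 1) * E + c = c - E + E * (l * Y) by rewrite /Y; ring.
  apply: (le_trans h); rewrite [leLHS]mulrDr; apply: le_trans (lerD (lexx _) h3) _.
  by rewrite le_eqVlt; apply/orP; left; apply/eqP; rewrite /Y; field.
have bL : bmeas (fun y => l * (expR (l * F y) * F y) -
    (l * S + 1) * expR (l * F y) + c) by bmeas_tac.
have bR : bmeas (fun y =>
   C * b * (expR (l * F y) * F y) - C * b * S * expR (l * F y) +
   (C * c / 2 * g y ^+ 2 - C * c * b * g y + C * c * (B - b) ^+ 2 / 2)).
  by bmeas_tac.
have H := le_mean P bL bR pt; move: H.
rewrite !meanD; try by bmeas_tac.
rewrite !meanN; try by bmeas_tac.
rewrite !mean_cst !meanZ; try by bmeas_tac.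
rewrite -mE -AE g0 => H.
have lnm : m * (l * S) + m - c <= m * ln m.
  have : ln (c / m) <= c / m - 1 by apply: ln_le_sub1; rewrite divr_gt0.
  rewrite ln_div ?posrE// expRK => h.
  have := ler_wpM2l (ltW m0) h.
  have -> : m * (c / m - 1) = c - m by field; rewrite gt_eqF.
  lra.
have h1 : C * c / 2 * (\int[P]_y g y ^+ 2) + C * c * (B - b) ^+ 2 / 2 <=
    C * ((s2 + (B - b) ^+ 2) / 2 * m).
  have -> : C * c / 2 * (\int[P]_y g y ^+ 2) + C * c * (B - b) ^+ 2 / 2 =
    C * ((\int[P]_y g y ^+ 2 + (B - b) ^+ 2) / 2 * c) by field.
  apply: ler_wpM2l => //.
  have i0 : 0 <= \int[P]_y g y ^+ 2 by apply: Rintegral_ge0 => y _; exact: sqr_ge0.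
  apply: ler_pM.
  - by rewrite divr_ge0// addr_ge0// sqr_ge0.
  - exact: ltW.
  - by rewrite ler_pM2r ?invr_gt0// lerD2r.
  - exact: cm.
lra.
Qed.

End single_site.

(** * Subadditivity of entropy *)

Section entropy_tensorization.
Context {d} {T : measurableType d} {R : realType} {n : nat}.
Variables (P : probability T R) (Q : probability (n.-tuple T) R).
Hypothesis QE : product_law P Q.
Implicit Types (f h : n.-tuple T -> R) (i : 'I_n) (x : n.-tuple T).

(** The members of [bmeas] whose logarithm and inverse are again in [bmeas]. *)
Definition bpos f := bmeas f /\ exists2 c, 0 < c & forall x, c <= f x.

Lemma bpos_gt0 f x : bpos f -> 0 < f x.
Proof. by move=> [_ [c c0 cf]]; exact: lt_le_trans (cf x). Qed.

Lemma bpos_ln f : bpos f -> bmeas (fun x => ln (f x)).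
Proof. by move=> [bf [c c0 cf]]; exact: (bmeas_ln c0). Qed.

Lemma bpos_inv f : bpos f -> bmeas (fun x => (f x)^-1).
Proof. by move=> [bf [c c0 cf]]; exact: (bmeas_inv c0). Qed.

Lemma bpos_resample i f : bpos f -> bpos (resample P i f).
Proof.
move=> [bf [c c0 cf]]; split; first exact: bmeas_resample.
by exists c => // x; apply: mean_ge => //; exact: bmeas_updl.
Qed.

Lemma bpos_expR f : bmeas f -> bpos (fun x => expR (f x)).
Proof.
move=> bf; split; first exact: bmeas_expR.
have [M fM] := bf.2; exists (expR (- M)); first exact: expR_gt0.
by move=> x; rewrite ler_expR; have := fM x; rewrite ler_norml => /andP[].
Qed.

Lemma mean_resampleM i f g : bmeas f -> bmeas g -> ignores i g ->
  \int[Q]_x (g x * f x) = \int[Q]_x (g x * resample P i f x).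
Proof.
move=> bf bg fg; rewrite -(mean_resample QE i (bmeasM bg bf)).
by rewrite resampleM.
Qed.

Definition resample_seq (s : seq 'I_n) f := foldr (resample P) f s.

Lemma bpos_resample_seq s f : bpos f -> bpos (resample_seq s f).
Proof. by move=> bf; elim: s => //= i s IH; exact: bpos_resample. Qed.

Lemma mean_resample_seq s f : bmeas f ->
  \int[Q]_x resample_seq s f x = \int[Q]_x f x.
Proof.
move=> bf; elim: s => //= i s IH; rewrite mean_resample//.
by elim: s {IH} => //= j s; exact: bmeas_resample.
Qed.

Lemma ignores_resample_seq s f i : i \in s -> ignores i (resample_seq s f).
Proof.
elim: s => //= j s IH; rewrite inE => /orP[/eqP ->|/IH].
  exact: ignores_resample.
exact: ignores_resample_other.
Qed.

Lemma ignores_constant f : (forall i, ignores i f) -> forall x x', f x = f x'.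
Proof.
move=> ff x x'.
pose y := foldr (fun i z => upd i (tnth x' i) z) x (enum 'I_n).
have -> : x' = y.
  apply: eq_from_tnth => j; rewrite /y.
  have : j \in enum 'I_n by rewrite mem_enum.
  elim: (enum 'I_n) => //= i s IH; rewrite inE tnth_upd.
  by case: eqP => [->//|_ /=]; exact: IH.
by rewrite /y; elim: (enum 'I_n) => //= i s ->; rewrite ff.
Qed.

(** Once every coordinate has been averaged out, a constant is left, and averaging
preserves the mean. *)
Lemma resample_enum_constant f x : bmeas f ->
  resample_seq (enum 'I_n) f x = \int[Q]_x f x.
Proof.
move=> bf; rewrite -(mean_resample_seq (enum 'I_n) bf).
rewrite -[LHS](mean_cst Q); apply: eq_Rintegral => y _.
apply: ignores_constant => i; apply: ignores_resample_seq.
by rewrite mem_enum.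
Qed.

(** The variational formula for conditional entropy. With [m] and [h1] the averages
of [f] and [h] over coordinate [i], the inequality [ln t <= t - 1] bounds
[f ln (h m / (h1 f))] by [h m / h1 - f], which has mean zero. *)
Lemma entropy_step i f h : bpos f -> bpos h ->
  \int[Q]_x (f x * ln (h x)) - \int[Q]_x (f x * ln (resample P i h x)) <=
  \int[Q]_x (f x * ln (f x)) -
  \int[Q]_x (resample P i f x * ln (resample P i f x)).
Proof.
move=> bf bh; pose m := resample P i f; pose h1 := resample P i h.
have bm : bpos m by exact: bpos_resample.
have bh1 : bpos h1 by exact: bpos_resample.
have fm : ignores i m by exact: ignores_resample.
have fh1 : ignores i h1 by exact: ignores_resample.
have [Bf Bh Bm Bh1] : [/\ bmeas f, bmeas h, bmeas m & bmeas h1].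
  by split; [case: bf|case: bh|case: bm|case: bh1].
have Eh g : bmeas g -> ignores i g ->
  \int[Q]_x (g x * h x) = \int[Q]_x (g x * h1 x) by exact: mean_resampleM.
have Ef g : bmeas g -> ignores i g ->
  \int[Q]_x (g x * f x) = \int[Q]_x (g x * m x) by exact: mean_resampleM.
rewrite -/m -/h1; clearbody m h1.
have Lf := bpos_ln bf; have Lh := bpos_ln bh; have Lm := bpos_ln bm.
have Lh1 := bpos_ln bh1; have Ih1 := bpos_inv bh1.
have pt x : f x * ln (h x) - f x * ln (h1 x) <=
    f x * ln (f x) - f x * ln (m x) + (m x / h1 x * h x - f x).
  have f0 := bpos_gt0 x bf; have h0 := bpos_gt0 x bh.
  have m0 := bpos_gt0 x bm; have h10 := bpos_gt0 x bh1.
  have t0 : 0 < m x * h x / (h1 x * f x) by rewrite divr_gt0 ?mulr_gt0.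
  have := ln_le_sub1 t0.
  rewrite ln_div ?posrE ?mulr_gt0// !lnM ?posrE// => /(ler_wpM2l (ltW f0)).
  have -> : f x * (m x * h x / (h1 x * f x) - 1) = m x / h1 x * h x - f x.
    by field; rewrite !gt_eqF.
  lra.
have bL : bmeas (fun x => f x * ln (h x) - f x * ln (h1 x)) by bmeas_tac.
have bR : bmeas (fun x => f x * ln (f x) - f x * ln (m x) +
  (m x / h1 x * h x - f x)) by bmeas_tac.
have H := le_mean Q bL bR pt; move: H.
rewrite !meanD; try by bmeas_tac.
rewrite !meanN; try by bmeas_tac.
have Bmh1 : bmeas (fun x => m x / h1 x) by exact: bmeasM.
rewrite (Eh _ Bmh1); last by move=> y x; rewrite fm fh1.
have -> : \int[Q]_x (m x / h1 x * h1 x) = \int[Q]_x f x.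
  transitivity (\int[Q]_x (1 * m x)).
    by apply: eq_Rintegral => x _; rewrite mul1r mulfVK// gt_eqF// bpos_gt0.
  rewrite -Ef//; last exact: bmeas_cst.
  by apply: eq_Rintegral => x _; rewrite mul1r.
have -> : \int[Q]_x (f x * ln (m x)) = \int[Q]_x (m x * ln (m x)).
  transitivity (\int[Q]_x (ln (m x) * f x)).
    by apply: eq_Rintegral => x _; rewrite mulrC.
  rewrite (Ef _ Lm); last by move=> y x; rewrite fm.
  by apply: eq_Rintegral => x _; rewrite mulrC.
by rewrite subrr addr0.
Qed.

(** The coordinates are averaged out one after the other, starting from [f] and
ending at its mean; by [entropy_step] each of these steps costs at most the
conditional entropy of [f] itself in the coordinate concerned. *)
Lemma entropy_subadditive f : bpos f ->
  \int[Q]_x (f x * ln (f x)) - (\int[Q]_x f x) * ln (\int[Q]_x f x) <=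
  \sum_(i < n) (\int[Q]_x (f x * ln (f x)) -
    \int[Q]_x (resample P i f x * ln (resample P i f x))).
Proof.
move=> bf; have [Bf _] := bf.
have H (s : seq 'I_n) : \int[Q]_x (f x * ln (f x)) -
    \int[Q]_x (f x * ln (resample_seq s f x)) <=
    \sum_(i <- s) (\int[Q]_x (f x * ln (f x)) -
      \int[Q]_x (resample P i f x * ln (resample P i f x))).
  elim: s => [|i s IH]; first by rewrite big_nil subrr.
  have aux (x y z w u : R) : y - z <= x - w -> x - y <= u -> x - z <= x - w + u.
    by lra.
  by rewrite big_cons; exact: aux (entropy_step i bf (bpos_resample_seq s bf)) IH.
have := H (enum 'I_n); rewrite big_enum/= => {}H; apply: le_trans H.
rewrite lerD2l lerN2 le_eqVlt; apply/orP; left; apply/eqP.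
transitivity (\int[Q]_x (ln (\int[Q]_x f x) * f x)).
  by apply: eq_Rintegral => x _; rewrite resample_enum_constant// mulrC.
by rewrite meanZ// mulrC.
Qed.

End entropy_tensorization.

(** * Entropy of the exponential of a supremum *)

Lemma sum_affine {R : pzRingType} (n : nat) (a c : R) (w : 'I_n -> R) :
  \sum_(i < n) (a + w i + c) = n%:R * a + \sum_(i < n) w i + n%:R * c.
Proof. by rewrite !big_split/= !sumr_const card_ord !mulr_natl. Qed.

(** Elimination of the sums over coordinates in [entropy_sup]: [u] and [v] stand for
the means of [f Z] and [f], [w] for [v ln v], and [s] for the sum of the means of
the [m_i ln m_i], where [m_i] is [f] averaged over coordinate [i]. *)
Lemma entropy_sup_arith {R : realFieldType} (l b u v w N s c k : R) :
  l * u - w <= N * (l * u) - s ->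
  c * b * ((N - 1) * u) <= N * ((c * b - l) * u) + s + N * (c * k * v) ->
  l * u - w <= c * (b * u + N * k * v).
Proof. by move=> h1 h2; lra. Qed.

Section supremum_entropy.
Context {d} {T : measurableType d} {R : realType} {n : nat}.
Variables (P : probability T R) (Q : probability (n.-tuple T) R).
Hypothesis QE : product_law P Q.
Variables (G : set (T -> R)) (Z : n.-tuple T -> R) (s2 b B : R).
Hypothesis n0 : (0 < n)%N.
Hypothesis G0 : G !=set0.
Hypothesis bG : forall g, G g -> bmeas g.
Hypothesis G_mean : forall g, G g -> \int[P]_y g y = 0.
Hypothesis G_var : forall g, G g -> \int[P]_y (g y ^+ 2) <= s2.
Hypothesis G_le : forall g y, G g -> g y <= B.
Hypothesis bZ : bmeas Z.
Hypothesis Z_ub : forall g x, G g -> \sum_(i < n) g (tnth x i) <= Z x.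
Hypothesis Z_approx : forall x e, 0 < e ->
  exists2 g, G g & Z x - e < \sum_(i < n) g (tnth x i).
Hypotheses (b0 : 0 < b) (bB : b <= B) (B2b : B < 2 * b).
Implicit Types (x : n.-tuple T) (i : 'I_n).

Definition partial_sum i x (g : T -> R) := \sum_(j < n | j != i) g (tnth x j).

Definition partial_sup i x := sup [set partial_sum i x g | g in G].

Lemma sum_upd i x g y :
  \sum_(j < n) g (tnth (upd i y x) j) = partial_sum i x g + g y.
Proof.
rewrite (bigD1 i)//= tnth_upd eqxx addrC; congr (_ + _).
by apply: eq_bigr => j /negbTE ji; rewrite tnth_upd ji.
Qed.

(** Since [g] has mean zero, its partial sum is the average of its full sum over the
missing observation, and full sums are at most [Z]. *)
Lemma has_sup_partial i x : has_sup [set partial_sum i x g | g in G].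
Proof.
split; first by have [g Gg] := G0; exists (partial_sum i x g); exists g.
exists (resample P i Z x) => _ [g Gg <-].
rewrite -[leLHS]addr0 -(G_mean Gg) -[X in X + _](mean_cst P) -meanD; last 2 first.
- exact: bmeas_cst.
- exact: bG.
apply: le_mean; first by apply: bmeasD; [exact: bmeas_cst|exact: bG].
  exact: bmeas_updl.
by move=> y; rewrite -sum_upd; exact: Z_ub.
Qed.

Lemma partial_sum_le i x g : G g -> partial_sum i x g <= partial_sup i x.
Proof.
move=> Gg; apply: ub_le_sup; first by case: (has_sup_partial i x).
by exists g.
Qed.

(** For a nearly optimal [g], leaving out each observation in turn counts every term
of the full sum [n - 1] times. *)
Lemma sum_partial_sup x : (n%:R - 1) * Z x <= \sum_(i < n) partial_sup i x.
Proof.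
have n1 : 0 <= n%:R - 1 :> R by rewrite subr_ge0 ler1n.
apply/ler_addgt0Pr => e e0.
have d0 : 0 < e / n%:R by rewrite divr_gt0// ltr0n.
have [g Gg Zg] := Z_approx x d0.
have H : (n%:R - 1) * \sum_(i < n) g (tnth x i) <= \sum_(i < n) partial_sup i x.
  have -> : (n%:R - 1) * \sum_(i < n) g (tnth x i) = \sum_(i < n) partial_sum i x g.
    transitivity (\sum_(i < n) (\sum_(j < n) g (tnth x j) - g (tnth x i))).
      rewrite sumrB sumr_const card_ord -mulr_natl; ring.
    apply: eq_bigr => i _; rewrite (bigD1 i)//= /partial_sum; ring.
  by apply: ler_sum => i _; exact: partial_sum_le.
have h2 : (n%:R - 1) * (Z x - e / n%:R) <= (n%:R - 1) * \sum_(i < n) g (tnth x i).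
  by rewrite ler_wpM2l// ltW.
have h3 : (n%:R - 1) * (e / n%:R) <= e.
  rewrite -[leRHS](@divfK _ n%:R) ?pnatr_eq0 -?lt0n// mulrC.
  by rewrite ler_wpM2l ?(ltW d0)//; lra.
lra.
Qed.

Variable l : R.
Hypothesis l0 : 0 < l.

Let f x := expR (l * Z x).
Let C := l ^+ 2 / (1 + b * l / 2).
Let K := (s2 + (B - b) ^+ 2) / 2.

Lemma bpos_exp_sup : bpos f.
Proof. by apply: (@bpos_expR _ _ _ _ (fun x => l * Z x)); bmeas_tac. Qed.

Lemma C_gt0 : 0 < C.
Proof.
rewrite /C divr_gt0 ?exprn_gt0//; have := mulr_gt0 b0 l0; lra.
Qed.

(** This is [site_entropy] for a member of the class whose partial sum is within [t]
of the supremum, in the limit of small [t]. The assumption [B < 2 b] leaves room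
for replacing [B] by [B + t]. *)
Lemma partial_entropy i x :
  l * resample P i (fun x => f x * Z x) x -
    resample P i f x * ln (resample P i f x) <=
  C * (b * (resample P i (fun x => f x * Z x) x -
            partial_sup i x * resample P i f x) + K * resample P i f x).
Proof.
have b0' := b0; have bB' := bB; have B2b' := B2b.
set A := resample P i (fun x => f x * Z x) x; set m := resample P i f x.
set z := partial_sup i x.
have m0 : 0 < m.
  by apply: bpos_gt0; exact: bpos_resample bpos_exp_sup.
apply/ler_addgt0Pr => e e0.
(* the error made by replacing the supremum by a near optimal member *)
pose k := C * m * (b + (B - b) + 1).
have C0 : 0 < C by exact: C_gt0.
have k1 : 0 < b + (B - b) + 1.
  by lra.
have k0 : 0 < k by rewrite /k mulr_gt0// mulr_gt0.
pose t := Num.min (e / k) (Num.min (2 * b - B) 1).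
have t0 : 0 < t by rewrite !lt_min divr_gt0// subr_gt0 B2b ltr01.
have t1 : t <= 1 by rewrite !ge_min lexx !orbT.
have t2 : B + t <= 2 * b.
  have h : t <= 2 * b - B by rewrite !ge_min lexx ?orbT.
  by lra.
have tk : k * t <= e.
  by rewrite -ler_pdivlMl// mulrC ge_min lexx.
have [_ [g Gg <-] Sz] := sup_adherent t0 (has_sup_partial i x).
rewrite -/(partial_sup i x) -/z in Sz.
have Sz' : partial_sum i x g <= z by exact: partial_sum_le.
set S := partial_sum i x g in Sz Sz'.
have bBt : b <= B + t by lra.
have ZS y : S + g y <= Z (upd i y x) by rewrite -sum_upd; exact: Z_ub.
have ZB y : Z (upd i y x) <= S + (B + t).
  apply/ler_addgt0Pr => e' e'0.
  have [g' Gg'] := Z_approx (upd i y x) e'0.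
  rewrite sum_upd => H; have := partial_sum_le i x Gg'; rewrite -/z.
  by have := G_le y Gg'; lra.
have H := site_entropy (bmeas_updl i x bZ) (bG Gg) (G_mean Gg) (G_var Gg) (ltW l0)
  b0 bBt t2 ZS ZB (erefl m) (erefl A).
move: H; rewrite -/C => H; apply: (le_trans H).
have -> : B + t - b = (B - b) + t by ring.
have h1 : C * (b * (A - S * m) + (s2 + (B - b + t) ^+ 2) / 2 * m) <=
  C * (b * (A - (z - t) * m) + (s2 + (B - b) ^+ 2 + t * (2 * (B - b) + 1)) / 2 * m).
  apply: ler_wpM2l; first exact: ltW.
  apply: lerD.
    apply: ler_wpM2l; first exact: ltW.
    by rewrite lerD2l lerN2 ler_pM2r//; lra.
  rewrite ler_pM2r// ler_pM2r ?invr_gt0//.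
  have tt : t * t <= t * 1 by rewrite ler_pM2l.
  by lra.
apply: (le_trans h1).
have -> : C * (b * (A - (z - t) * m) + (s2 + (B - b) ^+ 2 + t * (2 * (B - b) + 1)) / 2 * m) =
  C * (b * (A - z * m) + K * m) + (C * m * (b + (B - b) + 1 / 2)) * t by rewrite /K; field.
rewrite lerD2l; apply: le_trans tk; rewrite ler_pM2r// /k.
have Cm : 0 < C * m by exact: mulr_gt0.
by rewrite (ler_pM2l Cm); lra.
Qed.

(** The conditional bounds are summed over [i] with the help of [sum_partial_sup].
The partial suprema need not be measurable: they are integrated through
measurable majorants, which [partial_entropy] itself provides. *)
Lemma entropy_sup :
  l * \int[Q]_x (f x * Z x) - (\int[Q]_x f x) * ln (\int[Q]_x f x) <=
  C * (b * \int[Q]_x (f x * Z x) + n%:R * K * \int[Q]_x f x).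
Proof.
have b0' := b0; have bB' := bB; have B2b' := B2b; have l0' := l0.
have C0 : 0 < C by exact: C_gt0.
have bf : bpos f by exact: bpos_exp_sup.
have Bf : bmeas f by case: bf.
have BfZ : bmeas (fun x => f x * Z x) by exact: bmeasM.
pose A i := resample P i (fun x => f x * Z x).
pose m i := resample P i f.
have bA i : bmeas (A i) by exact: bmeas_resample.
have bm i : bpos (m i) by exact: bpos_resample.
have Bm i : bmeas (m i) by case: (bm i).
have Lm i := bpos_ln (bm i); have Im i := bpos_inv (bm i).
have fA i : ignores i (A i) by exact: ignores_resample.
have fm i : ignores i (m i) by exact: ignores_resample.
have EA i : \int[Q]_x A i x = \int[Q]_x (f x * Z x) by exact: mean_resample.
have Em i : \int[Q]_x m i x = \int[Q]_x f x by exact: mean_resample.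
have Ef i g : bmeas g -> ignores i g ->
  \int[Q]_x (g x * f x) = \int[Q]_x (g x * m i x) by exact: mean_resampleM.
have PE i x : l * A i x - m i x * ln (m i x) <=
    C * (b * (A i x - partial_sup i x * m i x) + K * m i x).
  exact: partial_entropy.
have S := entropy_subadditive QE bf.
have {}S : \int[Q]_x (f x * ln (f x)) -
    (\int[Q]_x f x) * ln (\int[Q]_x f x) <=
    \sum_(i < n) (\int[Q]_x (f x * ln (f x)) -
      \int[Q]_x (m i x * ln (m i x))) by exact: S.
clearbody A m.
(* measurable majorants of the partial suprema *)
pose N i x := (C * b - l) * A i x + m i x * ln (m i x) + C * K * m i x.
have N_ge i x : C * b * partial_sup i x <= N i x / m i x.
  rewrite ler_pdivlMr ?bpos_gt0//.
  by have := PE i x; rewrite /N; lra.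
have bN i : bmeas (N i) by rewrite /N; bmeas_tac.
have bNm i : bmeas (fun x => N i x / m i x) by exact: bmeasM.
have bNmf i : bmeas (fun x => N i x / m i x * f x).
  by apply: (bmeasM (bNm i)).
have E1 i : \int[Q]_x (N i x / m i x * f x) = \int[Q]_x N i x.
  rewrite (Ef i (fun x => N i x / m i x)).
  - by apply: eq_Rintegral => x _; rewrite mulfVK// gt_eqF// bpos_gt0.
  - exact: bNm.
  - by move=> y x; rewrite /N fA fm.
have E2 i : \int[Q]_x N i x = (C * b - l) * \int[Q]_x (f x * Z x) +
   \int[Q]_x (m i x * ln (m i x)) + C * K * \int[Q]_x f x.
  rewrite /N !meanD; try by bmeas_tac.
  by rewrite !meanZ ?EA ?Em//; bmeas_tac.
have H : C * b * ((n%:R - 1) * \int[Q]_x (f x * Z x)) <=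
    \sum_(i < n) \int[Q]_x N i x.
  under [leRHS]eq_bigr do rewrite -E1.
  rewrite -mean_sum; last exact: bNmf.
  rewrite mulrA -meanZ//; apply: le_mean.
  - by bmeas_tac.
  - exact: bmeas_sum.
  move=> x; rewrite -mulr_suml mulrCA mulrC [X in X <= _](_ : _ =
    (C * b * ((n%:R - 1) * Z x)) * f x); last by ring.
  rewrite ler_pM2r ?bpos_gt0//.
  apply: (@le_trans _ _ (C * b * \sum_(i < n) partial_sup i x)).
    apply: ler_wpM2l; last exact: sum_partial_sup.
    exact: ltW (mulr_gt0 C0 b0).
  by rewrite mulr_sumr; apply: ler_sum => i _; exact: N_ge.
have E3 : \int[Q]_x (f x * ln (f x)) = l * \int[Q]_x (f x * Z x).
  rewrite -meanZ//; apply: eq_Rintegral => x _.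
  by rewrite /f expRK; ring.
rewrite E3 sumrB sumr_const card_ord -mulr_natl in S.
move: H; under eq_bigr do rewrite E2.
rewrite sum_affine.
by move=> H; exact: entropy_sup_arith S H.
Qed.

End supremum_entropy.

(** * Herbst's argument *)

Section herbst.
Context {d} {T : measurableType d} {R : realType}.
Variables (Q : probability T R) (Z : T -> R).
Hypothesis bZ : bmeas Z.

Definition mgf (l : R) : R := \int[Q]_x expR (l * Z x).

Lemma mgf_gt0 l : 0 < mgf l.
Proof.
have [M ZM] := bZ.2; rewrite /mgf.
apply: (@lt_le_trans _ _ (expR (- (`|l| * M)))); first exact: expR_gt0.
apply: mean_ge; first by bmeas_tac.
move=> x; rewrite ler_expR.
have : `|l * Z x| <= `|l| * M by rewrite normrM ler_wpM2l.
by rewrite ler_norml => /andP[].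
Qed.

Lemma is_derive_mgf (a : R) :
  is_derive a 1 mgf (\int[Q]_x (expR (a * Z x) * Z x)).
Proof.
have [M ZM] := bZ.2.
pose f (l : R) (x : T) := expR (l * Z x).
have d1f (l : R) x : is_derive l 1 (f ^~ x) (expR (l * Z x) * Z x).
  rewrite /f; apply: is_derive_eq.
  by rewrite /GRing.scale/=; ring.
have Ia : `](a - 1), (a + 1)[%classic a.
  by rewrite /= in_itv/=; apply/andP; split; lra.
have intf l : `](a - 1), (a + 1)[%classic l -> Q.-integrable setT (EFin \o f l).
  by move=> _; apply: bmeas_integrable; rewrite /f; bmeas_tac.
have d1E l x : partial1of2 f l x = expR (l * Z x) * Z x.
  rewrite /partial1of2 derive1E.
  by rewrite (@derive_val _ _ _ _ _ _ _ (d1f l x)).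
have H := cvg_differentiation_under_integral (mu := Q) (f := f) measurableT Ia intf.
have {}H := H (fun l x _ _ => @ex_derive _ _ _ _ _ _ _ (d1f l x)).
have M0 : 0 <= M by rewrite (le_trans _ (ZM point)).
have {}H := H (fun=> expR ((`|a| + 1) * M) * M).
have {}H := H (fun _ => mulr_ge0 (expR_ge0 _) M0).
have {}H := H (bmeas_integrable Q (bmeas_cst _)).
have {}H : h^-1 *: (mgf (h + a) - mgf a) @[h --> 0^'] -->
    \int[Q]_x (expR (a * Z x) * Z x).
  have -> : \int[Q]_x (expR (a * Z x) * Z x) = \int[Q]_x partial1of2 f a x.
    by apply: eq_Rintegral => x _; rewrite d1E.
  apply: H => l x; rewrite /= in_itv/= => /andP[al la] _.
  rewrite d1E normrM ger0_norm ?expR_ge0// ler_pM ?expR_ge0// ler_expR.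
  apply: le_trans (ler_norm _) _; rewrite normrM ler_pM// ler_norml.
  by have := ler_norm a; have := ler_norm (- a); rewrite normrN; lra.
apply: DeriveDef; last first.
  by rewrite -derive1E /derive1; exact: cvg_lim H.
apply/cvg_ex => /=; exists (\int[Q]_x (expR (a * Z x) * Z x)).
by under eq_fun do rewrite scaler1.
Qed.

Lemma expR_le_quadratic (y : R) : y <= 1 / 2 -> expR y <= 1 + y + 2 * y ^+ 2.
Proof.
move=> y2; have h := expR_ge1Dx (- y).
have E : expR y * expR (- y) = 1 by rewrite expRxMexpNx_1.
have e0 := expR_gt0 y.
have : expR y * (1 - y) <= 1 by rewrite -[leRHS]E ler_pM2l.
have h2 : 1 <= (1 + y + 2 * y ^+ 2) * (1 - y).
  have -> : (1 + y + 2 * y ^+ 2) * (1 - y) = 1 + y ^+ 2 * (1 - 2 * y) by ring.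
  by rewrite lerDl mulr_ge0 ?sqr_ge0//; lra.
move=> h3; have := le_trans h3 h2; rewrite ler_pM2r//; lra.
Qed.

(** The behaviour of the logarithmic moment generating function near [0], which
starts the integration in [herbst]. *)
Lemma ln_mgf_le (M l : R) : (forall x, `|Z x| <= M) -> 0 < l -> l * M <= 1 / 2 ->
  ln (mgf l) <= l * \int[Q]_x Z x + 2 * M ^+ 2 * l ^+ 2.
Proof.
move=> ZM l0 lM; apply: le_trans (ln_le_sub1 (mgf_gt0 l)) _.
suff : mgf l <= 1 + l * \int[Q]_x Z x + 2 * M ^+ 2 * l ^+ 2 by lra.
have -> : 1 + l * \int[Q]_x Z x + 2 * M ^+ 2 * l ^+ 2 =
  \int[Q]_x (1 + l * Z x + 2 * M ^+ 2 * l ^+ 2).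
  rewrite !meanD; try by bmeas_tac.
  by rewrite !mean_cst meanZ.
apply: le_mean; try by bmeas_tac.
move=> x; have ZMx := ZM x; have [h1 h2] : - M <= Z x /\ Z x <= M.
  by move: ZMx; rewrite ler_norml => /andP[].
have h3 : l * Z x <= l * M by rewrite ler_pM2l.
apply: le_trans (expR_le_quadratic (_ : l * Z x <= 1 / 2)) _; first by lra.
rewrite lerD2l -mulrA ler_pM2l// exprMn mulrC ler_pM2r ?exprn_gt0//.
rewrite -[leLHS]real_normK ?num_real// ler_sqr ?nnegrE//.
exact: le_trans ZMx.
Qed.

Variables (b v : R).
Hypotheses (b0 : 0 < b) (v0 : 0 <= v).
Hypothesis meanZ0 : 0 <= \int[Q]_x Z x.
Hypothesis entropy_le : forall l : R, 0 < l ->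
  l * \int[Q]_x (expR (l * Z x) * Z x) - mgf l * ln (mgf l) <=
  l ^+ 2 / (1 + b * l / 2) *
  (b * \int[Q]_x (expR (l * Z x) * Z x) + v * mgf l).

(** The entropy bound is a differential inequality for [ln (mgf l)]; the integrating
factor [(1 - b l / 2)^2 / l] makes it say that
[ln (mgf l) (1 - b l / 2)^2 / l - v (l - b l^2 / 4)] is nonincreasing. At [0]
this function tends to the mean of [Z]. *)
Lemma herbst (l : R) : 0 < l -> b * l < 2 ->
  ln (mgf l) * (1 - b * l / 2) ^+ 2 <=
  l * (\int[Q]_x Z x + v * (l - b * l ^+ 2 / 4)).
Proof.
move=> l0 bl2; have b0' := b0; have v0' := v0.
pose h (t : R) := ln (mgf t) * (1 - b * t / 2) ^+ 2 * t^-1 - v * (t - b * t ^+ 2 / 4).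
pose D (t : R) := \int[Q]_x (expR (t * Z x) * Z x).
pose dh (t : R) := D t / mgf t * (1 - b * t / 2) ^+ 2 / t -
   ln (mgf t) * ((1 - b * t / 2) * (1 + b * t / 2)) / t ^+ 2 - v * (1 - b * t / 2).
have dhE (t : R) : 0 < t -> is_derive t 1 h (dh t).
  move=> t0.
  have d1 : is_derive t 1 (fun t => ln (mgf t)) (D t / mgf t).
    have := is_derive_mgf t => hm.
    have hl := is_derive1_ln (mgf_gt0 t).
    have := @is_derive1_comp R (@ln R) mgf t _ _ hl hm.
    by rewrite mulrC.
  have d2 : is_derive t 1 (fun t : R => t^-1) (- t ^- 2).
    have tn0 : t != 0 by rewrite gt_eqF.
    have dt : is_derive t (1 : R) (fun s : R => s) 1 by exact: is_derive_id.
    have := @is_deriveV R (fun s : R => s) t 1 1 tn0 dt.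
    by rewrite /GRing.scale/= mulr1.
  have d3 : is_derive t 1 (fun t : R => (1 - b * t / 2) ^+ 2) (- b * (1 - b * t / 2)).
    by apply: is_derive_eq; rewrite /GRing.scale/=; field.
  have d4 : is_derive t 1 (fun t : R => v * (t - b * t ^+ 2 / 4)) (v * (1 - b * t / 2)).
    by apply: is_derive_eq; rewrite /GRing.scale/=; field.
  have d5 := is_deriveB (is_deriveM (is_deriveM d1 d3) d2) d4.
  apply: (is_derive_eq d5).
  rewrite /GRing.scale/= /dh.
  rewrite -[X in X * - _]/(ln (mgf t) * (1 - b * t / 2) ^+ 2); field.
  by rewrite !gt_eqF// mgf_gt0.
have dh0 (t : R) : 0 < t -> b * t < 2 -> dh t <= 0.
  move=> t0 bt; have m0 := mgf_gt0 t.
  have bt0 : 0 < b * t by exact: mulr_gt0.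
  have := entropy_le t0; rewrite -/(D t); set m := mgf t in m0 *.
  set L := ln m; set c := 1 + b * t / 2.
  have c0 : 0 < c by rewrite /c; lra.
  rewrite mulrAC ler_pdivlMr// => H.
  have -> : dh t = (1 - b * t / 2) / (t ^+ 2 * m) *
     ((t * D t - m * L) * c - t ^+ 2 * (b * D t + v * m)).
    rewrite /dh -/m -/L /c; field; by rewrite !gt_eqF.
  rewrite mulr_ge0_le0//; last by rewrite subr_le0.
  by rewrite divr_ge0 ?mulr_ge0 ?sqr_ge0 ?(ltW m0)//; lra.
have hmono (e : R) : 0 < e -> e <= l -> h l <= h e.
  move=> e0 el.
  have pos (t : R) : t \in `]e, l[ -> 0 < t /\ b * t < 2.
    rewrite in_itv/= => /andP[et tl]; split; first exact: lt_trans et.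
    by apply: lt_trans bl2; rewrite ltr_pM2l.
  apply: (@ler0_derive1_nincr R h e l) => //.
  - by move=> t /pos[t0 _]; have := dhE t t0 => ?; exact: ex_derive.
  - move=> t /pos[t0 bt]; rewrite derive1E.
    by rewrite (@derive_val _ _ _ _ _ _ _ (dhE t t0)) dh0.
  - apply: continuous_in_subspaceT => t; rewrite inE/= in_itv/= => /andP[et _].
    have ? := dhE t (lt_le_trans e0 et).
    by apply: differentiable_continuous; apply/derivable1_diffP; exact: ex_derive.
have [M ZM] := bZ.2.
have M0 : 0 <= M by rewrite (le_trans _ (ZM point)).
suff H : h l <= \int[Q]_x Z x.
  have : l * h l <= l * \int[Q]_x Z x by rewrite ler_pM2l.
  have -> : l * h l = ln (mgf l) * (1 - b * l / 2) ^+ 2 - l * (v * (l - b * l ^+ 2 / 4)).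
    by rewrite /h; field; rewrite gt_eqF.
  lra.
apply/ler_addgt0Pr => e e0.
pose k := 2 * M ^+ 2 + 1.
have k0 : 0 < k by rewrite /k; have := sqr_ge0 M; lra.
pose t := Num.min l (Num.min (e / k) (1 / (2 * M + 1))).
have t0 : 0 < t by rewrite !lt_min l0 !divr_gt0//; lra.
have tl : t <= l by rewrite ge_min lexx.
have te : 2 * M ^+ 2 * t <= e.
  have : t * k <= e by rewrite -ler_pdivlMr// !ge_min lexx !orbT.
  by rewrite /k; have := sqr_ge0 M; nra.
have tM : t * M <= 1 / 2.
  have : t * (2 * M + 1) <= 1.
    by rewrite -ler_pdivlMr ?ge_min ?lexx ?orbT//; lra.
  by lra.
apply: (le_trans (hmono t t0 tl)).
have := ln_mgf_le ZM t0 tM => Hln.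
have bt2 : b * t < 2 by apply: le_lt_trans bl2; rewrite ler_pM2l.
have bt0 : 0 < b * t by exact: mulr_gt0.
rewrite /h.
have hv : 0 <= v * (t - b * t ^+ 2 / 4).
  apply: mulr_ge0 => //; have -> : t - b * t ^+ 2 / 4 = t * (1 - b * t / 4) by field.
  by rewrite mulr_ge0 ?(ltW t0)//; lra.
set s := (1 - b * t / 2) ^+ 2.
have s0 : 0 <= s by exact: sqr_ge0.
have s1 : s <= 1 by rewrite /s expr_le1//; lra.
have H : ln (mgf t) * s * t^-1 <= \int[Q]_x Z x + e.
  rewrite ler_pdivrMr//.
  apply: le_trans (_ : (t * \int[Q]_x Z x + 2 * M ^+ 2 * t ^+ 2) * s <= _).
    by rewrite ler_wpM2r.
  have -> : t * \int[Q]_x Z x + 2 * M ^+ 2 * t ^+ 2 = (\int[Q]_x Z x + 2 * M ^+ 2 * t) * t by ring.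
  rewrite mulrAC ler_pM2r//.
  apply: le_trans (_ : (\int[Q]_x Z x + 2 * M ^+ 2 * t) * 1 <= _); last by lra.
  rewrite ler_wpM2l//; have := sqr_ge0 M => ?.
  by rewrite addr_ge0// !mulr_ge0// ltW.
lra.
Qed.

End herbst.

(** * Tail of the supremum of an empirical process *)

Lemma measurable_ge d (T : measurableType d) (R : realType) (f : T -> R) (tau : R) :
  measurable_fun [set: T] f -> measurable [set x | tau <= f x].
Proof.
move=> mf; rewrite (_ : [set _ | _] = f @^-1` `[tau, +oo[%classic).
  by rewrite -[X in measurable X]setTI; apply: mf.
by apply/seteqP; split=> x /=; rewrite in_itv/= andbT.
Qed.

Section chernoff.
Context {d} {T : measurableType d} {R : realType}.
Variables (Q : probability T R) (Z : T -> R).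
Hypothesis bZ : bmeas Z.

Lemma markov_mgf (tau l : R) : 0 <= l ->
  (Q [set x | (tau <= Z x)%R] <= (mgf Q Z l * expR (- (l * tau)))%:E)%E.
Proof.
move=> l0; set A := [set x | _]; have mA : measurable A by exact: measurable_ge bZ.1.
have b1 : bmeas (\1_A : T -> R).
  split; first exact: measurable_indic.
  by exists 1 => x; rewrite indicE normr_nat lern1; case: (_ \in _).
have E : (Q A = (\int[Q]_x (\1_A x : R))%:E)%E.
  rewrite /Rintegral integral_indic// setIT fineK//.
  exact: fin_num_measure.
rewrite E lee_fin /mgf mulrC -meanZ; last by bmeas_tac.
apply: le_mean => //; first by bmeas_tac.
move=> x; rewrite -expRD indicE; case: (boolP (x \in A)) => [|_]; last by rewrite expR_ge0.
rewrite inE => Ax.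
rewrite -[leLHS]expR0 ler_expR addrC subr_ge0 ler_wpM2l//.
Qed.

(** Chernoff's bound at [l = 2 U / W], where [W] is the denominator of the exponent.
With [w = v + b (tau - U)], the hypothesis implies that [ln (mgf l)] is at most
[l (tau - U) + l^2 w / (1 - 3 b l / 4)], when [b l < 4/3]; the
choice of [l] is the one usual for such a bound, as in Bernstein's inequality. *)
Lemma subgamma_tail (b v tau U : R) :
  0 < b -> 0 < v -> 0 < U -> 0 <= \int[Q]_x Z x ->
  \int[Q]_x Z x <= tau - U ->
  (forall l, 0 < l -> b * l < 2 ->
    ln (mgf Q Z l) * (1 - b * l / 2) ^+ 2 <=
    l * (\int[Q]_x Z x + v * (l - b * l ^+ 2 / 4))) ->
  (Q [set x | (tau <= Z x)%R] <=
   (expR (- (U ^+ 2 / (4 * v + 4 * b * tau - 5 / 2 * b * U))))%:E)%E.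
Proof.
move=> b0 v0 U0 E0 EU H; set e := \int[Q]_x Z x in E0 EU H.
pose t := tau - U; pose w := v + b * t.
have t0 : 0 <= t by rewrite /t; lra.
have w0 : 0 < w by rewrite /w; have := mulr_ge0 (ltW b0) t0; lra.
have bU : 0 < b * U by exact: mulr_gt0.
pose W := 4 * v + 4 * b * tau - 5 / 2 * b * U; rewrite -/W.
have WE : W = 4 * w + 3 / 2 * (b * U) by rewrite /W /w /t; field.
have W0 : 0 < W by rewrite WE; lra.
pose l := 2 * U / W.
have lE : l = 2 * U / W by [].
have l0 : 0 < l by rewrite /l divr_gt0// mulr_gt0.
have blE : b * l = 2 * (b * U) / W by rewrite /l; ring.
clearbody l.
have bl2 : b * l < 4 / 3.
  by rewrite blE ltr_pdivrMr//; lra.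
have bl0 : 0 < b * l by exact: mulr_gt0.
have := H l l0 _; set s := (1 - b * l / 2) ^+ 2 => {}H.
have s0 : 0 < s by rewrite /s exprn_gt0//; lra.
have Hl : ln (mgf Q Z l) * s <= l * (t + v * (l - b * l ^+ 2 / 4)).
  apply: (le_trans (H _)); first lra.
  by rewrite ler_pM2l// lerD2r.
have c0 : 0 < 1 - 3 / 4 * (b * l) by lra.
have cE : 1 - 3 / 4 * (b * l) = 4 * w / W.
  have -> : 4 * w = W - 3 / 2 * (b * U) by rewrite WE; ring.
  by rewrite blE; field; rewrite gt_eqF.
(* this is where [(1 - b l / 2)^2 >= (1 - b l / 4) (1 - 3 b l / 4)] is used *)
have key : l * (t + v * (l - b * l ^+ 2 / 4)) <=
    (l * t + l ^+ 2 * w / (1 - 3 / 4 * (b * l))) * s.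
  have -> : l * (t + v * (l - b * l ^+ 2 / 4)) =
    l * t * s + l ^+ 2 * w * (1 - b * l / 4).
    by rewrite /s /w; field.
  have h : 1 - b * l / 4 <= s / (1 - 3 / 4 * (b * l)).
    rewrite ler_pdivlMr// /s.
    by have sq := sqr_ge0 (b * l); lra.
  have {}h : l ^+ 2 * w * (1 - b * l / 4) <= l ^+ 2 * w * (s / (1 - 3 / 4 * (b * l))).
    by rewrite ler_wpM2l// mulr_ge0 ?sqr_ge0// ltW.
  by rewrite mulrDl lerD2l; apply: (le_trans h); rewrite mulrA mulrAC.
have Hl2 : ln (mgf Q Z l) <= l * t + l ^+ 2 * w / (1 - 3 / 4 * (b * l)).
  by rewrite -(ler_pM2r s0); exact: le_trans Hl key.
apply: (le_trans (markov_mgf tau (ltW l0))).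
rewrite lee_fin -[X in X * _]lnK ?posrE ?mgf_gt0// -expRD ler_expR.
rewrite -lerBrDr; apply: (le_trans Hl2).
rewrite cE le_eqVlt; apply/orP; left; apply/eqP.
by rewrite lE /t; field; rewrite !gt_eqF.
Qed.

End chernoff.

Section supremum_tail.
Context {d} {T : measurableType d} {R : realType} {n : nat}.
Variables (P : probability T R) (Q : probability (n.-tuple T) R).

(** An inequality of Bousquet's type. The parameter [b] distributes the range [B]
between the variance term, which receives [(B - b)^2], and the term that is linear
in [tau]. *)
Lemma supremum_tail (G : set (T -> R)) (Z : n.-tuple T -> R) (s2 b B tau U : R) :
  product_law P Q -> (0 < n)%N -> G !=set0 ->
  (forall g, G g -> bmeas g) ->
  (forall g, G g -> \int[P]_y g y = 0) ->
  (forall g, G g -> \int[P]_y (g y ^+ 2) <= s2) ->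
  (forall g y, G g -> g y <= B) ->
  bmeas Z ->
  (forall g x, G g -> \sum_(i < n) g (tnth x i) <= Z x) ->
  (forall x e, 0 < e -> exists2 g, G g & Z x - e < \sum_(i < n) g (tnth x i)) ->
  0 < b -> b <= B -> B < 2 * b -> 0 < s2 + (B - b) ^+ 2 ->
  0 < U -> 0 <= \int[Q]_x Z x -> \int[Q]_x Z x <= tau - U ->
  (Q [set x | (tau <= Z x)%R] <= (expR (- (U ^+ 2 /
    (2 * n%:R * (s2 + (B - b) ^+ 2) + 4 * b * tau - 5 / 2 * b * U))))%:E)%E.
Proof.
move=> QE n0 G0 bG Gm Gv GB bZ Zub Zap b0 bB B2b K0 U0 EZ0 EZU.
pose v := n%:R * ((s2 + (B - b) ^+ 2) / 2).
have v0 : 0 < v by rewrite /v mulr_gt0 ?ltr0n// divr_gt0.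
have := @subgamma_tail _ _ _ Q Z bZ b v tau U b0 v0 U0 EZ0 EZU.
have -> : 4 * v = 2 * n%:R * (s2 + (B - b) ^+ 2) by rewrite /v; field.
apply=> l l0 bl.
apply: herbst => //; first exact: ltW.
move=> k k0; have := entropy_sup QE n0 G0 bG Gm Gv GB bZ Zub Zap b0 bB B2b k0.
by rewrite /mgf.
Qed.
End supremum_tail.

(** * Integration against a probability with a density *)

Section change_of_measure.
Context {d} {T : measurableType d} {R : realType}.
Variables (mu : {measure set T -> \bar R}) (P0 : probability T R) (p0 : T -> R).
Hypothesis dp0 : is_density mu p0.
Hypothesis hP0 : has_density mu P0 p0.

Import HBNNSimple.

Let mp0 : measurable_fun [set: T] p0. Proof. by case: dp0. Qed.
Let p00 y : 0 <= p0 y. Proof. by case: dp0. Qed.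

(** The density formula for sets extends to simple functions by linearity and to
nonnegative functions by monotone convergence. *)
Lemma ge0_integral_has_density (g : T -> R) :
  measurable_fun [set: T] g -> (forall y, 0 <= g y) ->
  (\int[P0]_y (g y)%:E = \int[mu]_y (g y * p0 y)%:E)%E.
Proof.
move=> mg g0.
have mEg : measurable_fun [set: T] (EFin \o g) by exact/measurable_EFinP.
pose f_ := nnsfun_approx measurableT mEg.
transitivity (limn (fun n => \int[P0]_x (f_ n x)%:E)%E).
  rewrite -monotone_convergence//.
  - apply: eq_integral => y _; apply/esym/cvg_lim => //.
    by apply: cvg_nnsfun_approx => // z _; rewrite /= lee_fin.
  - by move=> n; exact/measurable_EFinP/measurable_funP.
  - by move=> n y _; rewrite lee_fin.
  - by move=> y _ m n mn; rewrite lee_fin; exact/lefP/nd_nnsfun_approx.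
rewrite [X in limn X](_ : _ = (fun n => \int[mu]_x (f_ n x * p0 x)%:E)%E).
  rewrite -monotone_convergence//; last 3 first.
  - by move=> n; apply/measurable_EFinP; exact: measurable_realfun.measurable_funM.
  - by move=> n y _; rewrite lee_fin mulr_ge0.
  - move=> y _ m n mn; rewrite lee_fin ler_wpM2r//.
    exact/lefP/nd_nnsfun_approx.
  apply: eq_integral => y _; apply/cvg_lim => //.
  under eq_fun do rewrite EFinM.
  rewrite EFinM; apply: cvgeZr => //.
  by apply: cvg_nnsfun_approx => // z _; rewrite /= lee_fin.
apply/funext => n.
rewrite integralT_nnsfun sintegralE.
transitivity (\sum_(k \in range (f_ n))
    \int[mu]_x ((k * \1_(f_ n @^-1` [set k]) x) * p0 x)%:E)%E.
  apply: eq_fsbigr => r rf.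
  rewrite [X in (_ * X)%E](hP0 (measurable_sfunP _ (measurable_set1 _))).
  rewrite integral_mkcond.
  have r0 : 0 <= r by move: rf; rewrite inE => -[x _ <-].
  rewrite -ge0_integralZl//=; last 2 first.
  - apply/(measurable_restrictT _ _).1 => //; apply/measurable_EFinP.
    exact: measurable_funTS.
  - by move=> x _; apply: erestrict_ge0 => z _; rewrite lee_fin.
  apply: eq_integral => x _; rewrite patchE indicE.
  by case: ifPn => _; rewrite /= ?mulr1 ?mulr0 ?mul0r ?mule0// EFinM.
rewrite -ge0_integral_fsum//.
- apply: eq_integral => x _; rewrite fsumEFin// -mulr_fsuml.
  by rewrite -fimfunE.
- move=> r; apply/measurable_EFinP; apply: measurable_realfun.measurable_funM => //.
  by apply: measurable_realfun.measurable_funM.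
- move=> r x _; rewrite EFinM mule_ge0//; last by rewrite lee_fin.
  by rewrite nnfun_muleindic_ge0.
Qed.

End change_of_measure.

(** * Inequalities between the likelihood ratio and root differences *)

Section square_root_inequalities.
Context {R : realFieldType}.
Implicit Types a b c : R.

Let pos_or_zero a b : 0 <= a -> 0 <= b ->
  (a = 0 /\ b = 0) \/ 0 < a ^+ 2 + b ^+ 2.
Proof.
move=> a0 b0; have [->|an0] := eqVneq a 0; have [->|bn0] := eqVneq b 0.
- by left.
- by right; rewrite expr0n/= add0r exprn_gt0// lt_neqAle eq_sym bn0.
- by right; rewrite expr0n/= addr0 exprn_gt0// lt_neqAle eq_sym an0.
- by right; rewrite addr_gt0// exprn_gt0// lt_neqAle eq_sym ?an0 ?bn0.
Qed.

(** Used for the roots [a], [b] of [p0], [p]. After multiplication by [a^2 + b^2] the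
difference is [2 a b (a - b)^2]. *)
Lemma ratio_ge_hellinger a b : 0 <= a -> 0 <= b ->
  3 * a ^+ 2 - b ^+ 2 + (a - b) ^+ 2 <=
  4 * a ^+ 2 / (a ^+ 2 + b ^+ 2) * a ^+ 2.
Proof.
move=> a0 b0; have [[-> ->]|s0] := pos_or_zero a0 b0; first lra.
rewrite mulrAC ler_pdivlMr// -subr_ge0.
have -> : 4 * a ^+ 2 * a ^+ 2 -
    (3 * a ^+ 2 - b ^+ 2 + (a - b) ^+ 2) * (a ^+ 2 + b ^+ 2) =
    2 * (a * b) * (a - b) ^+ 2 by ring.
by rewrite mulr_ge0 ?sqr_ge0// mulr_ge0// mulr_ge0.
Qed.

(** After multiplication by [a^2 + b^2] the difference is the square of
[c (a^2 + b^2) - 2 a b]. *)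
Lemma ratio_le_hellinger a b c : 0 <= a -> 0 <= b ->
  4 * a ^+ 2 / (a ^+ 2 + b ^+ 2) * a ^+ 2 <=
  3 * a ^+ 2 - b ^+ 2 + (1 - c) ^+ 2 * (a ^+ 2 + b ^+ 2) +
  2 * c * (a - b) ^+ 2.
Proof.
move=> a0 b0; have [[-> ->]|s0] := pos_or_zero a0 b0; first lra.
rewrite mulrAC ler_pdivrMr// -subr_ge0.
set u := (X in 0 <= X).
have -> : u = (c * (a ^+ 2 + b ^+ 2) - 2 * (a * b)) ^+ 2 by rewrite /u; ring.
exact: sqr_ge0.
Qed.

(** After multiplication by [(a^2 + b^2)^2] the difference is [(a - b)^2] times an
affine function of [c]. The constants 146/25 and 81/25 are chosen so that its
values [r0] at [c = 0] and [r1] at [c = 1] are sums of squares. *)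
Lemma ratio_variance a b c : 0 <= a -> 0 <= b -> 0 <= c -> c <= 1 ->
  (4 * a ^+ 2 / (a ^+ 2 + b ^+ 2) - 2 - c) ^+ 2 * a ^+ 2 <=
  c ^+ 2 * a ^+ 2 - 2 * c * (a ^+ 2 - b ^+ 2) +
  (146 / 25 - 81 / 25 * c) * (a - b) ^+ 2.
Proof.
move=> a0 b0 c0 c1; have [[-> ->]|s0] := pos_or_zero a0 b0; first lra.
have -> : (4 * a ^+ 2 / (a ^+ 2 + b ^+ 2) - 2 - c) ^+ 2 * a ^+ 2 =
  (4 * a ^+ 2 - (2 + c) * (a ^+ 2 + b ^+ 2)) ^+ 2 * a ^+ 2 /
     (a ^+ 2 + b ^+ 2) ^+ 2 by field; rewrite gt_eqF.
rewrite ler_pdivrMr ?exprn_gt0// -subr_ge0.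
set u := (X in 0 <= X).
pose r0 := 146 / 25 * (a ^+ 2 + b ^+ 2) ^+ 2 - 4 * a ^+ 2 * (a + b) ^+ 2.
pose r1 := 13 / 5 * (a ^+ 2 + b ^+ 2) ^+ 2 -
  2 * (a + b) ^+ 2 * (a ^+ 2 - b ^+ 2).
have -> : u = (a - b) ^+ 2 * ((1 - c) * r0 + c * r1).
  by rewrite /u /r0 /r1; field.
have r00 : 0 <= r0.
  rewrite /r0; have h1 := sqr_ge0 (a ^+ 2 - 50 / 23 * (a * b) - 3 / 5 * b ^+ 2).
  have h2 := sqr_ge0 (a * b - 121 / 60 * b ^+ 2).
  have h3 := sqr_ge0 (b ^+ 2). have h4 := sqr_ge0 (a * b).
  by lra.
have r10 : 0 <= r1.
  rewrite /r1; have h1 := sqr_ge0 (a ^+ 2 - 10 / 3 * (a * b) - 3 / 2 * b ^+ 2).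
  have h2 := sqr_ge0 (a * b - 3 * b ^+ 2).
  have h3 := sqr_ge0 (b ^+ 2). have h4 := sqr_ge0 (a * b).
  by lra.
rewrite mulr_ge0 ?sqr_ge0// addr_ge0// mulr_ge0//; lra.
Qed.

End square_root_inequalities.

(** * Hellinger distance and moments of the likelihood ratio *)

Section hellinger_theory.
Context {d} {T : measurableType d} {R : realType}.
Variable mu : {measure set T -> \bar R}.
Implicit Types p q : T -> R.

Definition hellinger_sq p q := \int[mu]_y (Num.sqrt (p y) - Num.sqrt (q y)) ^+ 2.

Lemma hellinger_sq_ge0 p q : 0 <= hellinger_sq p q.
Proof. by apply: Rintegral_ge0 => y _; exact: sqr_ge0. Qed.

Lemma sqr_hellinger p q : hellinger mu p q ^+ 2 = hellinger_sq p q.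
Proof. by rewrite sqr_sqrtr// hellinger_sq_ge0. Qed.

Lemma hellinger_ge0 p q : 0 <= hellinger mu p q.
Proof. exact: sqrtr_ge0. Qed.

Lemma hellingerC p q : hellinger mu p q = hellinger mu q p.
Proof.
by congr Num.sqrt; apply: eq_Rintegral => y _; rewrite -sqrrN opprB.
Qed.

Lemma hellinger_le p q s : 0 <= s ->
  (hellinger mu p q <= s) = (hellinger_sq p q <= s ^+ 2).
Proof.
by move=> s0; rewrite -sqr_hellinger ler_sqr ?nnegrE// hellinger_ge0.
Qed.

Lemma density_integrable p : is_density mu p ->
  mu.-integrable [set: T] (EFin \o p).
Proof.
move=> [mp p0 p1]; apply/integrableP; split; first exact/measurable_EFinP.
under eq_integral do rewrite /= ger0_norm//.
by rewrite p1 ltry.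
Qed.

Lemma density_mean p : is_density mu p -> \int[mu]_y p y = 1.
Proof. by move=> [_ _ p1]; rewrite /Rintegral p1. Qed.

Lemma measurable_sqrt_density p : is_density mu p ->
  measurable_fun [set: T] (fun y => Num.sqrt (p y)).
Proof.
move=> [mp p0 _]; under eq_fun do rewrite -powR12_sqrt//.
exact: (measurableT_comp (@measurable_powR R (2^-1)) mp).
Qed.

Lemma dominated_integrable (f g : T -> R) : measurable_fun [set: T] f ->
  mu.-integrable [set: T] (EFin \o g) -> (forall y, `|f y| <= g y) ->
  mu.-integrable [set: T] (EFin \o f).
Proof.
move=> mf ig fg; apply: le_integrable ig => //.
  exact/measurable_EFinP.
move=> y _ /=; rewrite lee_fin; apply: le_trans (fg y) (ler_norm _).
Qed.

Lemma integrable_add (f g : T -> R) :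
  mu.-integrable [set: T] (EFin \o f) -> mu.-integrable [set: T] (EFin \o g) ->
  mu.-integrable [set: T] (EFin \o (fun y => f y + g y)).
Proof. by move=> fi gi; apply: (integrableD measurableT fi gi). Qed.

Lemma integrable_scale (f : T -> R) (k : R) :
  mu.-integrable [set: T] (EFin \o f) ->
  mu.-integrable [set: T] (EFin \o (fun y => k * f y)).
Proof. by move=> fi; exact: (integrableZl measurableT k fi). Qed.

Lemma hellinger_integrable p q : is_density mu p -> is_density mu q ->
  mu.-integrable [set: T]
    (EFin \o (fun y => (Num.sqrt (p y) - Num.sqrt (q y)) ^+ 2)).
Proof.
move=> dp dq; have [_ p0 _] := dp; have [_ q0 _] := dq.
apply: (@dominated_integrable _ (fun y => p y + q y)).
- under eq_fun do rewrite expr2.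
  have m : measurable_fun [set: T] (fun y => Num.sqrt (p y) - Num.sqrt (q y)).
    apply: measurable_realfun.measurable_funB;
      exact: measurable_sqrt_density.
  exact: measurable_realfun.measurable_funM.
- by apply: integrable_add; exact: density_integrable.
- move=> y; rewrite ger0_norm ?sqr_ge0//.
  rewrite -{2}[p y]sqr_sqrtr// -{2}[q y]sqr_sqrtr//.
  have := sqrtr_ge0 (p y); have := sqrtr_ge0 (q y).
  set a := Num.sqrt (p y); set b := Num.sqrt (q y) => b0 a0.
  by have := mulr_ge0 a0 b0; lra.
Qed.

(** Under this identity the pointwise inequalities between the ratio and
[a p0 + b p + c (sqrt p0 - sqrt p)^2] become bounds on its moments. *)
Lemma mean_combination p q (a b c : R) : is_density mu p -> is_density mu q ->
  let f y := a * p y + b * q y +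
    c * (Num.sqrt (p y) - Num.sqrt (q y)) ^+ 2 in
  mu.-integrable [set: T] (EFin \o f) /\
  \int[mu]_y f y = a + b + c * hellinger_sq p q.
Proof.
move=> dp dq f; have ip := density_integrable dp.
have iq := density_integrable dq; have ih := hellinger_integrable dp dq.
have i1 := integrable_scale a ip; have i2 := integrable_scale b iq.
have i3 := integrable_scale c ih; have i4 := integrable_add i1 i2.
split; first exact: (integrable_add i4 i3).
rewrite (RintegralD measurableT i4 i3) (RintegralD measurableT i1 i2).
rewrite !RintegralZl//.
by rewrite (density_mean dp) (density_mean dq) !mulr1.
Qed.

Lemma hellinger_sq_le2 p q : is_density mu p -> is_density mu q ->
  hellinger_sq p q <= 2.
Proof.
move=> dp dq; have [_ p0 _] := dp; have [_ q0 _] := dq.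
have [i1 e1] := mean_combination 1 1 0 dp dq.
have -> : 2 = 1 + 1 + 0 * hellinger_sq p q :> R by ring.
rewrite -e1; apply: le_Rintegral => //; first exact: hellinger_integrable.
move=> y _; rewrite mul0r addr0 !mul1r.
rewrite -{2}[p y]sqr_sqrtr// -{2}[q y]sqr_sqrtr//.
have := sqrtr_ge0 (p y); have := sqrtr_ge0 (q y).
set a := Num.sqrt (p y); set b := Num.sqrt (q y) => b0 a0.
by have := mulr_ge0 a0 b0; lra.
Qed.

End hellinger_theory.

Section likelihood_ratio_moments.
Context {d} {T : measurableType d} {R : realType}.
Variables (mu : {measure set T -> \bar R}) (P0 : probability T R).
Variables (p0 p : T -> R).
Hypotheses (dp0 : is_density mu p0) (dp : is_density mu p).
Hypothesis hP0 : has_density mu P0 p0.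

Let f := likelihood_ratio p0 p.
Let m := \int[P0]_y f y.
Let h := hellinger_sq mu p0 p.

Let p0_ge0 y : 0 <= p0 y. Proof. by case: dp0. Qed.
Let p_ge0 y : 0 <= p y. Proof. by case: dp. Qed.

Lemma likelihood_ratio_ge0 y : 0 <= f y.
Proof. by rewrite /f /likelihood_ratio divr_ge0 ?addr_ge0// mulr_ge0. Qed.

Lemma likelihood_ratio_le4 y : f y <= 4.
Proof.
rewrite /f /likelihood_ratio; have [s0|s0] := ltP 0 (p0 y + p y).
  by rewrite ler_pdivrMr//; have := p_ge0 y; lra.
have -> : p0 y = 0 by have := p0_ge0 y; have := p_ge0 y; lra.
by rewrite mulr0 mul0r.
Qed.

Lemma bmeas_likelihood_ratio : bmeas f.
Proof.
split; last first.
  by exists 4 => y; rewrite ger0_norm ?likelihood_ratio_ge0 ?likelihood_ratio_le4.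
have [mp0 _ _] := dp0; have [mp _ _] := dp.
apply: measurable_realfun.measurable_funM.
  exact: measurable_realfun.measurable_funM.
apply: measurable_inv_pos; last by move=> y; rewrite addr_ge0.
exact: measurable_realfun.measurable_funD.
Qed.

Lemma mean_has_density (g : T -> R) : bmeas g -> (forall y, 0 <= g y) ->
  mu.-integrable [set: T] (EFin \o (fun y => g y * p0 y)) /\
  \int[P0]_y g y = \int[mu]_y (g y * p0 y).
Proof.
move=> [mg [M gM]] g0; split; last first.
  by rewrite /Rintegral (ge0_integral_has_density dp0 hP0).
have [mp0 _ _] := dp0.
apply: (@dominated_integrable _ _ _ _ _ (fun y => M * p0 y)).
- exact: measurable_realfun.measurable_funM.
- by apply: integrable_scale; exact: density_integrable.
- by move=> y; rewrite normrM [X in _ * X]ger0_norm// ler_wpM2r.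
Qed.

Let sqrt_p0 y : p0 y = Num.sqrt (p0 y) ^+ 2. Proof. by rewrite sqr_sqrtr. Qed.
Let sqrt_p y : p y = Num.sqrt (p y) ^+ 2. Proof. by rewrite sqr_sqrtr. Qed.

Lemma mean_ratio_ge : 2 + h <= m.
Proof.
have [i1 e1] := mean_has_density bmeas_likelihood_ratio likelihood_ratio_ge0.
have [i2 e2] := mean_combination 3 (-1) 1 dp0 dp.
have -> : 2 + h = 3 + -1 + 1 * h by ring.
rewrite /m e1 -e2; apply: le_Rintegral => // y _.
have := ratio_ge_hellinger (sqrtr_ge0 (p0 y)) (sqrtr_ge0 (p y)).
rewrite -sqrt_p0 -sqrt_p /f /likelihood_ratio; lra.
Qed.

(** The free parameter of [ratio_le_hellinger] is optimal at [1 - q / 2]. *)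
Lemma mean_ratio_le q : h <= q -> q <= 2 -> m <= 2 + 2 * q - q ^+ 2 / 2.
Proof.
move=> hq q2; pose c := 1 - q / 2.
have [i1 e1] := mean_has_density bmeas_likelihood_ratio likelihood_ratio_ge0.
have [i2 e2] := mean_combination (3 + (1 - c) ^+ 2) ((1 - c) ^+ 2 - 1) (2 * c) dp0 dp.
have c0 : 0 <= 2 * c by rewrite /c; lra.
apply: (@le_trans _ _ (3 + (1 - c) ^+ 2 + ((1 - c) ^+ 2 - 1) + 2 * c * h)); last first.
  apply: le_trans (_ : 3 + (1 - c) ^+ 2 + ((1 - c) ^+ 2 - 1) + 2 * c * q <= _).
    by rewrite lerD2l ler_wpM2l.
  by rewrite /c; lra.
rewrite /m e1 -e2; apply: le_Rintegral => // y _.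
have := ratio_le_hellinger c (sqrtr_ge0 (p0 y)) (sqrtr_ge0 (p y)).
rewrite -sqrt_p0 -sqrt_p /f /likelihood_ratio; lra.
Qed.

(** The variance is at most the mean squared deviation from [2 + c], for any [c]. *)
Lemma mean_ratio_variance q c : h <= q -> 0 <= c -> c <= 1 ->
  \int[P0]_y ((m - f y) ^+ 2) <= c ^+ 2 + (146 / 25 - 81 / 25 * c) * q.
Proof.
move=> hq c0 c1; have bf := bmeas_likelihood_ratio.
pose g y := (f y - 2 - c) ^+ 2.
have bg : bmeas g by rewrite /g; bmeas_tac.
apply: (@le_trans _ _ (\int[P0]_y g y)).
  (* the mean minimizes the quadratic risk *)
  rewrite -subr_ge0 -meanB//; last by bmeas_tac.
  have -> : \int[P0]_x (g x - (m - f x) ^+ 2) =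
      \int[P0]_x ((2 * m - 2 * (2 + c)) * f x + ((2 + c) ^+ 2 - m ^+ 2)).
    by apply: eq_Rintegral => y _; rewrite /g; ring.
  rewrite meanD; [|by bmeas_tac..].
  rewrite meanZ// mean_cst -/m.
  have -> : (2 * m - 2 * (2 + c)) * m + ((2 + c) ^+ 2 - m ^+ 2) = (m - 2 - c) ^+ 2 by ring.
  exact: sqr_ge0.
have g0 y : 0 <= g y by exact: sqr_ge0.
have [i1 e1] := mean_has_density bg g0.
have [i2 e2] := mean_combination (c ^+ 2 - 2 * c) (2 * c) (146 / 25 - 81 / 25 * c) dp0 dp.
have k0 : 0 <= 146 / 25 - 81 / 25 * c by lra.
apply: (@le_trans _ _ (c ^+ 2 - 2 * c + 2 * c + (146 / 25 - 81 / 25 * c) * h)); last first.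
  by rewrite subrK lerD2l ler_wpM2l.
rewrite e1 -e2; apply: le_Rintegral => // y _.
have := ratio_variance (sqrtr_ge0 (p0 y)) (sqrtr_ge0 (p y)) c0 c1.
rewrite -sqrt_p0 -sqrt_p /g /f /likelihood_ratio; lra.
Qed.

End likelihood_ratio_moments.

(** * Empirical means, and segments in a convex class *)

Section empirical_integral.
Context {d} {T : measurableType d} {R : realType} {n : nat}.

Lemma empirical_mean (x : n.-tuple T) (f : T -> R) :
  measurable_fun [set: T] f -> (forall y, 0 <= f y) ->
  \int[empirical R x]_y f y = n%:R^-1 * \sum_(i < n) f (tnth x i).
Proof.
move=> mf f0; rewrite /Rintegral /empirical.
have mEf : measurable_fun [set: T] (EFin \o f) by exact/measurable_EFinP.
rewrite ge0_integral_mscale//; last by move=> y _; rewrite lee_fin.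
rewrite ge0_integral_measure_sum//; last by move=> y _; rewrite lee_fin.
rewrite (eq_bigr (fun i : 'I_n => (f (tnth x i))%:E)).
  by rewrite sumEFin.
move=> i _; rewrite valK/= integral_dirac//.
by rewrite diracT mul1e.
Qed.

End empirical_integral.

Section convex_density_class_theory.
Context {d} {T : measurableType d} {R : realType}.
Variables (mu : {measure set T -> \bar R}) (F : set (T -> R)).
Hypothesis hF : convex_density_class mu F.

Definition segment (p q : T -> R) (a : R) (y : T) : R := a * p y + (1 - a) * q y.

Lemma segment_class p q a : F p -> F q -> 0 <= a -> a <= 1 -> F (segment p q a).
Proof.
move=> Fp Fq a0 a1; have [_ cF] := hF.
have i01 : Itv.spec (@Itv.num_sem R) (Itv.Real `[0%Z, 1%Z]) a.
  by rewrite /= /Itv.num_sem/= in_itv/= a0 a1 ger0_real.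
have := @cF p q (Itv.mk i01); rewrite !inE => /(_ Fp Fq).
congr (F _).
Qed.

Variables (p0 p : T -> R).
Hypotheses (Fp0 : F p0) (Fp : F p).

Let dF q : F q -> is_density mu q. Proof. by have [h _] := hF; exact: h. Qed.

Lemma sqrt_dist_le (a b : R) : 0 <= a -> 0 <= b ->
  `|Num.sqrt a - Num.sqrt b| <= Num.sqrt `|a - b|.
Proof.
wlog ab : a b / b <= a.
  move=> h a0 b0; have [/h|/ltW/h] := leP b a; first exact.
  by rewrite distrC [in `|a - b|]distrC; exact.
move=> a0 b0; rewrite !ger0_norm ?subr_ge0 ?ler_wsqrtr//.
rewrite -[leLHS]ger0_norm ?subr_ge0 ?ler_wsqrtr// -sqrtr_sqr ler_wsqrtr//.
have h := ler_wsqrtr ab.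
have := sqr_sqrtr a0; have := sqr_sqrtr b0; have := sqrtr_ge0 b.
set u := Num.sqrt a in h *; set v := Num.sqrt b in h *.
move=> v0 <- <-; have : 0 <= v * (u - v) by rewrite mulr_ge0// subr_ge0.
lra.
Qed.

(** Two points of the segment differ by [(a - b) (p - p0)]. So their roots differ by
at most [sqrt |a - b| sqrt |p - p0|], and the product of this bound with
[2 sqrt p0] is dominated by the integrable [sqrt |a - b| (2 p0 + p)]. *)
Lemma hellinger_sq_segment_dist (a b : R) : 0 <= a <= 1 -> 0 <= b <= 1 ->
  `|hellinger_sq mu p0 (segment p p0 a) - hellinger_sq mu p0 (segment p p0 b)| <=
  3 * Num.sqrt `|a - b|.
Proof.
wlog : a b / hellinger_sq mu p0 (segment p p0 b) <=
    hellinger_sq mu p0 (segment p p0 a).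
  move=> h a01 b01; have [/h|/ltW/h] := leP (hellinger_sq mu p0 (segment p p0 b))
    (hellinger_sq mu p0 (segment p p0 a)); first exact.
  by rewrite distrC [in `|a - b|]distrC; exact.
move=> h /andP[a0 a1] /andP[b0 b1]; rewrite ger0_norm ?subr_ge0// => {h}.
set pa := segment p p0 a; set pb := segment p p0 b.
have dp0 := dF Fp0; have dp := dF Fp.
have da : is_density mu pa by apply: dF; exact: segment_class.
have db : is_density mu pb by apply: dF; exact: segment_class.
set e := Num.sqrt `|a - b|; have e0 : 0 <= e by exact: sqrtr_ge0.
have [_ p0_ge0 _] := dp0; have [_ p_ge0 _] := dp.
have [_ pa_ge0 _] := da; have [_ pb_ge0 _] := db.
have [i1 E1] := mean_combination 0 (-1) 1 dp0 da.
have [i2 E2] := mean_combination 0 (-1) 1 dp0 db.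
have [i3 E3] := mean_combination (2 * e) e 0 dp0 dp.
suff : 0 + -1 + 1 * hellinger_sq mu p0 pa <=
    0 + -1 + 1 * hellinger_sq mu p0 pb + (2 * e + e + 0 * hellinger_sq mu p0 p).
  by lra.
rewrite -E1 -E2 -E3 -(RintegralD measurableT i2 i3); apply: le_Rintegral => //.
  exact: integrable_add i2 i3.
move=> y _.
have ea : pa y = Num.sqrt (pa y) ^+ 2 by rewrite sqr_sqrtr.
have eb : pb y = Num.sqrt (pb y) ^+ 2 by rewrite sqr_sqrtr.
have e0' : p0 y = Num.sqrt (p0 y) ^+ 2 by rewrite sqr_sqrtr.
have D : Num.sqrt (pb y) - Num.sqrt (pa y) <= e * Num.sqrt `|p y - p0 y|.
  apply: le_trans (ler_norm _) _.
  apply: le_trans (sqrt_dist_le (pb_ge0 y) (pa_ge0 y)) _.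
  rewrite /e -sqrtrM// -normrM distrC.
  rewrite (_ : pa y - pb y = (a - b) * (p y - p0 y))//.
  by rewrite /pa /pb /segment; ring.
set r := Num.sqrt `|p y - p0 y| in D.
have r2 : r ^+ 2 <= p y + p0 y.
  rewrite sqr_sqrtr//; apply: le_trans (ler_normB _ _) _.
  by rewrite !ger0_norm.
have w0 := sqrtr_ge0 (p0 y).
have h1 : Num.sqrt (p0 y) * (Num.sqrt (pb y) - Num.sqrt (pa y)) <=
    Num.sqrt (p0 y) * (e * r) by rewrite ler_wpM2l.
have h2 : e * (2 * (Num.sqrt (p0 y) * r)) <= e * (2 * p0 y + p y).
  rewrite ler_wpM2l//; have := sqr_ge0 (Num.sqrt (p0 y) - r).
  by move: r2 e0'; lra.
by move: h1 h2 ea eb e0'; lra.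
Qed.

Lemma clamp_dist (a b : R) :
  `|Num.max 0 (Num.min a 1) - Num.max 0 (Num.min b 1)| <= `|a - b|.
Proof.
wlog ab : a b / b <= a.
  move=> h; have [/h//|/ltW/h] := leP b a.
  by rewrite distrC [in X in _ <= X -> _]distrC.
rewrite [leRHS]ger0_norm ?subr_ge0// ler_norml.
by apply/andP; split; case: (leP a 1) => ?; case: (leP b 1) => ?;
  case: (leP 0 a) => ?; case: (leP 0 b) => ?; rewrite ?(max_r ler01); lra.
Qed.

Lemma exists_segment_at (s : R) : 0 < s -> s <= hellinger mu p0 p ->
  exists a, [/\ 0 < a, a <= 1 & hellinger_sq mu p0 (segment p p0 a) = s ^+ 2].
Proof.
move=> s0 sh.
(* clamping makes the path, and with it [g], continuous on the whole line *)
pose clamp (t : R) : R := Num.max 0 (Num.min t 1).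
have c01 t : 0 <= clamp t <= 1.
  by rewrite /clamp; apply/andP; split; case: (leP t 1) => ?;
    case: (leP 0 t) => ?; rewrite ?(max_r ler01); lra.
have cid t : 0 <= t <= 1 -> clamp t = t.
  move=> /andP[t0 t1]; rewrite /clamp.
  by case: (leP t 1) => ?; case: (leP 0 t) => ?; rewrite ?(max_r ler01); lra.
pose g (t : R) : R := hellinger_sq mu p0 (segment p p0 (clamp t)).
have seg0 : segment p p0 0 = p0 by apply/funext => y; rewrite /segment; ring.
have seg1 : segment p p0 1 = p by apply/funext => y; rewrite /segment; ring.
have g0 : g 0 = 0.
  rewrite /g cid ?lexx ?ler01// seg0 /hellinger_sq.
  rewrite -[RHS](mul0r (fine (mu setT))).
  rewrite -Rintegral_cst//; apply: eq_Rintegral => y _.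
  by rewrite subrr expr0n.
have g1 : g 1 = hellinger mu p0 p ^+ 2.
  by rewrite /g cid ?lexx ?ler01// seg1 sqr_hellinger.
have cg : continuous g.
  move=> t; apply/cvgrPdist_le => /= e e0; near=> u.
  apply: le_trans (hellinger_sq_segment_dist (c01 t) (c01 u)) _.
  have : `|t - u| <= (e / 3) ^+ 2.
    near: u; apply: cvgr_dist_le; first exact: cvg_id.
    by rewrite exprn_gt0// divr_gt0.
  move=> h; have {}h := le_trans (clamp_dist t u) h.
  have := ler_wsqrtr h; rewrite sqrtr_sqr [`|e / 3|]ger0_norm; last by rewrite divr_ge0// ltW.
  by lra.
have [a a01 ga] : exists2 c, c \in `[0, 1] & g c = s ^+ 2.
  apply: IVT => //; first exact: continuous_subspaceT.
  rewrite g0 g1.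
  have h0 : 0 < hellinger mu p0 p ^+ 2 by rewrite exprn_gt0// (lt_le_trans s0).
  rewrite (min_l (ltW h0)) (max_r (ltW h0)) sqr_ge0/= ler_sqr ?nnegrE//.
    exact: ltW.
  exact: hellinger_ge0.
move: a01; rewrite in_itv/= => /andP[a0 a1].
exists a; split => //; last by rewrite -ga /g cid ?a0.
rewrite lt_neqAle a0 andbT; apply/eqP => a0'.
by move: ga; rewrite -a0' g0 => /esym/eqP; rewrite sqrf_eq0 gt_eqF.
Unshelve. all: by end_near. Qed.

End convex_density_class_theory.

(** * The basic inequality for the maximum likelihood estimator *)

Section maximum_likelihood.
Context {d} {T : measurableType d} {R : realType} {n : nat}.
Variables (mu : {measure set T -> \bar R}) (F : set (T -> R)).
Variables (P0 : probability T R) (p0 : T -> R).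
Hypothesis hF : convex_density_class mu F.
Hypothesis Fp0 : F p0.
Hypothesis hP0 : has_density mu P0 p0.
Hypothesis n0 : (0 < n)%N.
Implicit Types (x : n.-tuple T) (p : T -> R).

Let dF q : F q -> is_density mu q. Proof. by have [h _] := hF; exact: h. Qed.

Lemma lne_le_tangent (u v : R) : 0 <= u -> 0 < v ->
  (lne u%:E <= (ln v + (u / v - 1))%:E)%E.
Proof.
move=> u0 v0; have [->|un0] := eqVneq u 0; first by rewrite le0_lneNy// leNye.
have {}u0 : 0 < u by rewrite lt_neqAle eq_sym un0.
rewrite lne_EFin// lee_fin -lerBlDl -ln_div ?posrE//.
by apply: ln_le_sub1; rewrite divr_gt0.
Qed.

(** Let [m] be the midpoint of [p0] and the point of the segment at [a]. Since [m] is
not more likely than [p], the tangent inequality for [ln] at [m] shows that the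
[p / m - 1] have a nonnegative sum, and [4 p0 / (p0 + (a p + (1 - a) p0))] is
equal to [2 - a / (1 - a / 2) (p / m - 1)]. *)
Lemma mle_ratio_sum x p a : (forall i, 0 < p0 (tnth x i)) -> is_mle x F p ->
  0 < a -> a <= 1 ->
  \sum_(i < n) likelihood_ratio p0 (segment p p0 a) (tnth x i) <= 2 * n%:R.
Proof.
move=> px [Fp pmax] a0 a1.
have [_ p_ge0 _] := dF Fp.
pose m := segment p p0 (a / 2).
have Fm : F m by apply: (segment_class hF) => //; lra.
have m_gt0 i : 0 < m (tnth x i).
  rewrite /m /segment ltr_wpDl ?mulr_ge0 ?p_ge0//; first lra.
  by rewrite mulr_gt0//; lra.
have := pmax _ Fm; rewrite /log_likelihood => H.
have nV0 : 0 < n%:R^-1 :> R by rewrite invr_gt0 ltr0n.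
have {H} H : \sum_(i < n) ln (m (tnth x i)) <=
    \sum_(i < n) (ln (m (tnth x i)) + (p (tnth x i) / m (tnth x i) - 1)).
  rewrite -(ler_pM2l nV0) -lee_fin !EFinM -!sumEFin.
  apply: le_trans (le_trans _ H) _.
    by apply: lee_wpmul2l; [rewrite lee_fin ltW|
      apply: lee_sum => i _; rewrite lne_EFin].
  apply: lee_wpmul2l; first by rewrite lee_fin ltW.
  by apply: lee_sum => i _; exact: lne_le_tangent.
have {}H : 0 <= \sum_(i < n) (p (tnth x i) / m (tnth x i) - 1).
  by move: H; rewrite big_split/= -lerBlDl subrr.
have c0 : 0 < 1 - a / 2 by lra.
have -> : \sum_(i < n) likelihood_ratio p0 (segment p p0 a) (tnth x i) =
    2 * n%:R - a / (1 - a / 2) * \sum_(i < n) (p (tnth x i) / m (tnth x i) - 1).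
  have -> : 2 * n%:R = \sum_(i < n) 2 :> R.
    by rewrite sumr_const card_ord mulr_natr.
  rewrite mulr_sumr -sumrB; apply: eq_bigr => i _.
  have := m_gt0 i; rewrite /likelihood_ratio /m /segment.
  set u := p0 _; set v := p _ => h.
  by field; rewrite !gt_eqF//; lra.
by rewrite gerBl mulr_ge0// divr_ge0// ltW.
Qed.

Definition centered_ratio p (y : T) : R :=
  \int[P0]_z likelihood_ratio p0 p z - likelihood_ratio p0 p y.

Definition ratio_class (t : R) : set (T -> R) :=
  [set centered_ratio p | p in [set p | F p /\ hellinger mu p0 p <= t]].

Lemma bmeas_centered_ratio p : F p -> bmeas (centered_ratio p).
Proof.
move=> Fp; rewrite /centered_ratio.
have := bmeas_likelihood_ratio (dF Fp0) (dF Fp) => ?; by bmeas_tac.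
Qed.

Lemma mean_centered_ratio p : F p -> \int[P0]_y centered_ratio p y = 0.
Proof.
move=> Fp; have b := bmeas_likelihood_ratio (dF Fp0) (dF Fp).
by rewrite /centered_ratio meanB ?mean_cst ?subrr//; exact: bmeas_cst.
Qed.

Lemma average_sub (c : R) (g : 'I_n -> R) :
  n%:R^-1 * \sum_(i < n) (c - g i) = c - n%:R^-1 * \sum_(i < n) g i.
Proof.
rewrite sumrB sumr_const card_ord mulrBr -[c *+ n]mulr_natr mulrCA.
by rewrite mulVf ?mulr1// pnatr_eq0 -lt0n.
Qed.

Lemma local_supE t x : local_sup mu P0 F p0 t x =
  sup [set n%:R^-1 * \sum_(i < n) g (tnth x i) | g in ratio_class t].
Proof.
congr sup; apply/seteqP; split => [_ [p [Fp ht] <-]|_ [_ [p [Fp ht] <-] <-]] /=.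
  exists (centered_ratio p); first by exists p.
  rewrite empirical_mean; [|exact: (bmeas_likelihood_ratio (dF Fp0) (dF Fp)).1
    |exact: likelihood_ratio_ge0 (dF Fp0) (dF Fp)].
  by rewrite /centered_ratio average_sub.
exists p => //.
rewrite empirical_mean; [|exact: (bmeas_likelihood_ratio (dF Fp0) (dF Fp)).1
  |exact: likelihood_ratio_ge0 (dF Fp0) (dF Fp)].
by rewrite /centered_ratio average_sub.
Qed.

Lemma centered_ratio_norm p y : F p -> `|centered_ratio p y| <= 4.
Proof.
move=> Fp; have b := bmeas_likelihood_ratio (dF Fp0) (dF Fp).
have f0 := likelihood_ratio_ge0 (dF Fp0) (dF Fp).
have f4 := likelihood_ratio_le4 (dF Fp0) (dF Fp).
have m0 : 0 <= \int[P0]_z likelihood_ratio p0 p z by exact: mean_ge.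
have m4 : \int[P0]_z likelihood_ratio p0 p z <= 4 by exact: mean_le.
rewrite ler_norml /centered_ratio; have := f0 y; have := f4 y.
by move=> h1 h2; apply/andP; split; lra.
Qed.

Lemma ratio_average_norm p x : F p ->
  `|n%:R^-1 * \sum_(i < n) centered_ratio p (tnth x i)| <= 4.
Proof.
move=> Fp; rewrite normrM ger0_norm ?invr_ge0//.
rewrite mulrC ler_pdivrMr ?ltr0n//.
apply: le_trans (ler_norm_sum _ _ _) _.
rewrite mulrC mulr_natl -[X in _ *+ X]card_ord -sumr_const.
by apply: ler_sum => i _; exact: centered_ratio_norm.
Qed.

Lemma ratio_class_nonempty t : 0 <= t -> ratio_class t !=set0.
Proof.
move=> t0; exists (centered_ratio p0); exists p0 => //; split => //.
rewrite hellinger_le// /hellinger_sq.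
under eq_Rintegral do rewrite subrr expr0n.
by rewrite Rintegral_cst// mul0r sqr_ge0.
Qed.

Lemma has_sup_ratio_average t x : 0 <= t ->
  has_sup [set n%:R^-1 * \sum_(i < n) g (tnth x i) | g in ratio_class t].
Proof.
move=> t0; split.
  by have [g Gg] := ratio_class_nonempty t0; eexists; exists g.
exists 4 => _ [_ [p [Fp _] <-] <-].
by rewrite (le_trans (ler_norm _))// ratio_average_norm.
Qed.

Lemma local_sup_ub t x g : 0 <= t -> ratio_class t g ->
  \sum_(i < n) g (tnth x i) <= n%:R * local_sup mu P0 F p0 t x.
Proof.
move=> t0 Gg; rewrite -ler_pdivrMl ?ltr0n// local_supE.
by apply: ub_le_sup; [case: (has_sup_ratio_average x t0)|exists g].
Qed.

Lemma local_sup_approx t x e : 0 <= t -> 0 < e ->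
  exists2 g, ratio_class t g &
    n%:R * local_sup mu P0 F p0 t x - e < \sum_(i < n) g (tnth x i).
Proof.
move=> t0 e0; have d0 : 0 < e / n%:R by rewrite divr_gt0// ltr0n.
have [_ [g Gg <-]] := sup_adherent d0 (has_sup_ratio_average x t0).
rewrite -local_supE => h; exists g => //.
have N0 : n%:R != 0 :> R by rewrite pnatr_eq0 -lt0n.
move: h; set L := local_sup _ _ _ _ _ _; set S := \sum_(i < n) _ => h.
have -> : n%:R * L - e = n%:R * (L - e / n%:R) by field.
have -> : S = n%:R * (n%:R^-1 * S) by field.
by rewrite ltr_pM2l// ltr0n.
Qed.

Lemma local_sup_norm t x : 0 <= t -> `|local_sup mu P0 F p0 t x| <= 4.
Proof.
move=> t0; rewrite local_supE ler_norml; apply/andP; split.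
  have [g Gg] := ratio_class_nonempty t0.
  apply: le_trans (ub_le_sup _ (ex_intro2 _ _ g Gg erefl)); last first.
    by case: (has_sup_ratio_average x t0).
  have [p [Fp _] <-] := Gg.
  by have := ratio_average_norm x Fp; rewrite ler_norml => /andP[].
apply: ge_sup; first by case: (has_sup_ratio_average x t0).
move=> _ [_ [p [Fp _] <-] <-].
by rewrite (le_trans (ler_norm _))// ratio_average_norm.
Qed.

(** At the point of the segment from [p0] to [p] that has distance [s] to [p0], the
ratio has mean at least [2 + s^2] and empirical mean at most [2]. *)
Lemma mle_local_sup x p s : (forall i, 0 < p0 (tnth x i)) -> is_mle x F p ->
  0 < s -> s <= hellinger mu p p0 -> s ^+ 2 <= local_sup mu P0 F p0 s x.
Proof.
move=> px mle s0; rewrite hellingerC => sh; have [Fp _] := mle.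
have [a [a0 a1 ha]] := exists_segment_at hF Fp0 Fp s0 sh.
have Fq : F (segment p p0 a) by apply: (segment_class hF) => //; exact: ltW.
have Gq : ratio_class s (centered_ratio (segment p p0 a)).
  by exists (segment p p0 a) => //; split => //; rewrite hellinger_le ?ha// ltW.
have := local_sup_ub x (ltW s0) Gq.
rewrite /centered_ratio sumrB sumr_const card_ord -[_ *+ n]mulr_natl => H.
have M := mean_ratio_ge (dF Fp0) (dF Fq) hP0; rewrite ha in M.
have S := mle_ratio_sum px mle a0 a1.
rewrite -(ler_pM2l (_ : 0 < n%:R)) ?ltr0n//; apply: le_trans H.
have : n%:R * (2 + s ^+ 2) <= n%:R * \int[P0]_z likelihood_ratio p0 (segment p p0 a) z.
  by rewrite ler_wpM2l.
by lra.
Qed.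

End maximum_likelihood.

(** * The law of the sample, and the constants of the exponent *)

Section sample_law.
Context {d d'} {Omega : measurableType d} {T : measurableType d'} {R : realType}.
Variables (Pr : probability Omega R) (P0 : probability T R) (n : nat).
Variable X : 'I_n -> {RV Pr >-> T}.

Definition sample (w : Omega) : n.-tuple T := [tuple X i w | i < n].

Lemma measurable_sample : measurable_fun [set: Omega] sample.
Proof.
apply/measurable_fun_tnthP => i.
rewrite (_ : _ \o _ = X i); first exact: measurable_funP.
by apply/funext => w /=; rewrite tnth_mktuple.
Qed.

HB.instance Definition _ := isMeasurableFun.Build _ _ _ _ sample measurable_sample.

Definition sample_distribution : probability (n.-tuple T) R :=
  distribution Pr (sample : {RV Pr >-> n.-tuple T}).

Lemma sample_distributionE A : sample_distribution A = Pr (sample @^-1` A).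
Proof. by []. Qed.

Hypothesis hX : iid P0 X.

Lemma sample_product_law : product_law P0 sample_distribution.
Proof.
move=> A mA; have [ind law] := hX.
rewrite sample_distributionE.
have -> : sample @^-1` rectangle A =
    \bigcap_(i in [set` [set: 'I_n]%SET]) (X i @^-1` A i).
  apply/seteqP; split => w /=; rewrite /rectangle/=.
    by move=> h i _; have := h i; rewrite tnth_mktuple.
  by move=> h i; rewrite tnth_mktuple; apply: h; rewrite /= inE.
rewrite ind//; under eq_bigl do rewrite inE.
by apply: eq_bigr => i _; exact: (law i _ (mA i)).
Qed.

Lemma mean_sample (f : n.-tuple T -> R) : bmeas f ->
  ('E_Pr[fun w => f (sample w)] = (\int[sample_distribution]_x f x)%:E)%E.
Proof.
move=> bf; have [mf _] := bf.
have i1 : Pr.-integrable [set: Omega] (EFin \o f \o sample).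
  apply: (@bmeas_integrable _ _ _ Pr (f \o sample)); split.
    exact: (measurableT_comp mf measurable_sample).
  by have [_ [M fM]] := bf; exists M => w; exact: fM.
rewrite unlock /Rintegral fineK; last first.
  exact: integrable_fin_num (bmeas_integrable _ bf).
by rewrite integral_distribution//; exact/measurable_EFinP.
Qed.

(** The tangent inequality for the logarithm is applied at densities that are at
least a positive multiple of [p0], so [p0] has to be positive at the
observations. *)
Lemma sample_density_gt0 (mu : {measure set T -> \bar R}) (p0 : T -> R) :
  is_density mu p0 -> has_density mu P0 p0 ->
  exists N : set Omega, [/\ measurable N, Pr N = 0%E &
    forall w, ~ N w -> forall i, 0 < p0 (tnth (sample w) i)].
Proof.
move=> [mp0 p00 _] hP0; have [_ law] := hX.
pose Z := [set y | p0 y = 0].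
have mZ : measurable Z.
  rewrite (_ : Z = p0 @^-1` [set 0]); last by [].
  by rewrite -[X in measurable X]setTI; exact: mp0.
have Z0 : P0 Z = 0%E.
  by rewrite hP0// integral0_eq// => y Zy; rewrite Zy.
exists (\bigcup_(i in [set: 'I_n]) (X i @^-1` Z)); split.
- apply: fin_bigcup_measurable => // i _.
  by rewrite -[X in measurable X]setTI; exact: measurable_funP.
- have mi (i : 'I_n) : measurable (X i @^-1` Z).
    by rewrite -[X in measurable X]setTI; exact: measurable_funP.
  rewrite (_ : \bigcup_(i in _) _ = \big[setU/set0]_(i < n) (X i @^-1` Z)).
    suff [] : measurable (\big[setU/set0]_(i < n) (X i @^-1` Z)) /\
      Pr (\big[setU/set0]_(i < n) (X i @^-1` Z)) = 0%E by [].
    elim/big_ind : _ => [|A B [mA A0] [mB B0]|i _].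
    + by split; [exact: measurable0|exact: measure0].
    + by split; [exact: measurableU|rewrite measureU0].
    + by split => //; have := law i Z mZ; rewrite Z0.
  rewrite -bigcup_seq/=; apply/seteqP; split => w [i _ h]; exists i => //=.
  by rewrite mem_index_enum.
- move=> w Nw i; rewrite tnth_mktuple lt_neqAle p00 andbT eq_sym.
  by apply/eqP => h; apply: Nw; exists i.
Qed.

End sample_law.

Section tail_arithmetic.
Context {R : realType}.

Lemma quartic_ge0 (q : R) : 2 / 3 < q -> q <= 2 ->
  0 <= - 2 + 33 / 5 * q - 6 * q ^+ 2 + 2 * q ^+ 3 - q ^+ 4 / 8.
Proof.
move=> q1 q2; have [t [-> t1 t2]] : exists t, [/\ q = 1 + t, - 1 / 3 <= t & t <= 1].
  by exists (q - 1); split; lra.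
have -> : - 2 + 33 / 5 * (1 + t) - 6 * (1 + t) ^+ 2 + 2 * (1 + t) ^+ 3 - (1 + t) ^+ 4 / 8 =
  19 / 40 + t / 10 - 3 / 4 * t ^+ 2 + 3 / 2 * t ^+ 3 - t ^+ 4 / 8 by field.
have [t0|/ltW t0] := leP 0 t.
  have h1 : 0 <= t * (t - 27 / 100) ^+ 2 by rewrite mulr_ge0 ?sqr_ge0.
  have h3 : 0 <= t * (1 - t) by rewrite mulr_ge0 //; lra.
  have h2 : 0 <= t ^+ 3 * (1 - t) by rewrite mulr_ge0 ?exprn_ge0//; lra.
  by lra.
have h1 : 0 <= (- t) * (1 / 3 + t) by rewrite mulr_ge0//; lra.
have h2 : 0 <= t ^+ 2 * (1 / 3 + t) by rewrite mulr_ge0 ?sqr_ge0//; lra.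
have h3 : 0 <= t ^+ 2 * ((- t) * (1 / 3 + t)) by rewrite mulr_ge0 ?sqr_ge0.
by lra.
Qed.

(** In [local_sup_tail], [q] is the squared radius, [M] bounds the excess of the mean
ratio over 2, and [c] is the centering of [mean_ratio_variance]. A centering
proportional to [q] is good for small [q]; for larger [q] the best one is the
largest one allowed. *)
Lemma variance_range_bound (q : R) : 0 <= q -> q <= 2 ->
  let M := 2 * q - q ^+ 2 / 2 in
  exists c, [/\ 0 <= c, c <= 1 &
    2 * (c ^+ 2 + (146 / 25 - 81 / 25 * c) * q + (M / 2) ^+ 2) +
    4 * (2 + M / 2) * q <= 99 / 5 * q].
Proof.
(* the centering [3 q / 2] reaches 1 at [q = 2/3] *)
move=> q0 q2 M; have [q23|q23] := leP q (2 / 3).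
  exists (3 / 2 * q); split; [lra..|].
  rewrite -subr_ge0; set u := (X in 0 <= X).
  have -> : u = q * (3 / 25 - 39 / 50 * q + 2 * q ^+ 2 - q ^+ 3 / 8).
    by rewrite /u /M; field.
  rewrite mulr_ge0//; have := sqr_ge0 (q - 1 / 5); nra.
exists 1; split; [lra..|].
rewrite -subr_ge0; set u := (X in 0 <= X).
have -> : u = - 2 + 33 / 5 * q - 6 * q ^+ 2 + 2 * q ^+ 3 - q ^+ 4 / 8.
  by rewrite /u /M; field.
exact: quartic_ge0.
Qed.

(** Here [y = x / (t0 + x)], and [th] is the relative gap between [s^2] and the bound
on the mean of the local supremum. As [th] may be smaller than [y], the
denominator on the right may be the larger one; the second-order part of the lower
bound on [th] compensates this. *)
Lemma exponent_comparison (e y th : R) : 0 < e -> e <= 1 -> 0 <= y -> y < 1 ->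
  e * y * (1 + (1 - e) * y / 4) <= th -> th <= 1 ->
  (e * y) ^+ 2 / (99 / 5 - 5 * y) <= th ^+ 2 / (99 / 5 - 5 * th).
Proof.
move=> e0 e1 y0 y1 hth th1.
have ey0 : 0 <= e * y by rewrite mulr_ge0// ltW.
have k0 : 0 <= (1 - e) * y by rewrite mulr_ge0//; lra.
set w := e * y * (1 + (1 - e) * y / 4) in hth.
have w0 : 0 <= w by rewrite /w mulr_ge0//; lra.
have ew : e * y <= w.
  by rewrite /w -[leLHS]mulr1 ler_wpM2l//; lra.
rewrite ler_pdivrMr; last by lra.
rewrite mulrAC ler_pdivlMr; last by lra.
have h1 : w ^+ 2 <= th ^+ 2 by rewrite ler_sqr ?nnegrE//; lra.
apply: (@le_trans _ _ (w ^+ 2 * (99 / 5 - 5 * y))); last first.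
  by rewrite ler_wpM2r//; lra.
apply: (@le_trans _ _ ((e * y) ^+ 2 * (99 / 5 - 5 * (e * y)))).
  by rewrite ler_wpM2l ?sqr_ge0//; lra.
have -> : w ^+ 2 * (99 / 5 - 5 * y) =
  (e * y) ^+ 2 * ((1 + (1 - e) * y / 4) ^+ 2 * (99 / 5 - 5 * y)).
  by rewrite /w; ring.
rewrite ler_wpM2l ?sqr_ge0//.
set k := (1 - e) * y in k0 *.
have -> : 99 / 5 - 5 * (e * y) = 99 / 5 - 5 * y + 5 * k by rewrite /k; ring.
have : 0 <= k * y by rewrite mulr_ge0.
have : 0 <= k * (1 - y) by rewrite mulr_ge0//; lra.
have : 0 <= k ^+ 2 * (99 / 5 - 5 * y) by rewrite mulr_ge0 ?sqr_ge0//; lra.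
lra.
Qed.

End tail_arithmetic.

(** * Tail of the Hellinger loss *)

Section mle_tail.
Context {R : realType} {d d'} {T : measurableType d} {Omega : measurableType d'}.
Variables (mu : {measure set T -> \bar R}) (F : set (T -> R)).
Hypothesis hF : convex_density_class mu F.
Variable p0 : T -> R.
Hypothesis hp0 : F p0.
Variable P0 : probability T R.
Hypothesis hP0 : has_density mu P0 p0.
Variables (Pr : probability Omega R) (n : nat).
Hypothesis hn : (0 < n)%N.
Variable X : 'I_n -> {RV Pr >-> T}.
Hypothesis hX : iid P0 X.
Variable phat : Omega -> T -> R.
Hypothesis hphat : forall w, is_mle (sample X w) F (phat w).
Hypothesis mphat : measurable_fun [set: Omega] (fun w => hellinger mu (phat w) p0).

Let dF q : F q -> is_density mu q. Proof. by have [h _] := hF; exact: h. Qed.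

(** The inclusion of events is [mle_local_sup], outside the null event on which [p0]
vanishes at some observation. *)
Lemma mle_tail_local_sup (s : R) : 0 < s ->
  measurable_fun [set: n.-tuple T] (fun x : n.-tuple T => local_sup mu P0 F p0 s x) ->
  (Pr [set w | (s <= hellinger mu (phat w) p0)%R] <=
   sample_distribution X
     [set x | (n%:R * s ^+ 2 <= n%:R * local_sup mu P0 F p0 s x)%R])%E.
Proof.
move=> s0 mG.
have [N [mN N0 Npos]] := sample_density_gt0 hX (dF hp0) hP0.
set A := [set w | _]; set B := [set x | _].
have mA : measurable A by exact: measurable_ge.
have mB : measurable (sample X @^-1` B).
  rewrite -[X in measurable X]setTI; apply: measurable_sample => //.
  rewrite (_ : B = (fun x : n.-tuple T => local_sup mu P0 F p0 s x) @^-1` `[s ^+ 2, +oo[%classic).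
    by rewrite -[X in measurable X]setTI; exact: mG.
  apply/seteqP; split=> x /=; rewrite /B/= in_itv/= andbT.
    by rewrite ler_pM2l// ltr0n.
  by rewrite ler_pM2l// ltr0n.
rewrite sample_distributionE -(measureU0 mB mN N0).
apply: le_measure; rewrite ?inE//; first exact: measurableU.
move=> w Aw; have [Nw|Nw] := pselect (N w); first by right.
left; rewrite /B/= ler_pM2l ?ltr0n//.
exact: (mle_local_sup hF hp0 hP0 hn (Npos w Nw) (hphat w) s0 Aw).
Qed.

(** The ratios are nonnegative with mean at most [2 + M], so [2 + M] is an upper bound
for the centered class; [b = 2 + M / 2] is the split for which the constants of
[variance_range_bound] come out. *)
Lemma local_sup_tail (s th : R) : 0 < s -> s ^+ 2 <= 2 -> 0 < th -> th <= 1 ->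
  measurable_fun [set: n.-tuple T] (fun x : n.-tuple T => local_sup mu P0 F p0 s x) ->
  \int[sample_distribution X]_x local_sup mu P0 F p0 s x <= s ^+ 2 * (1 - th) ->
  (sample_distribution X
     [set x | (n%:R * s ^+ 2 <= n%:R * local_sup mu P0 F p0 s x)%R] <=
   (expR (- (n%:R * s ^+ 2 * (th ^+ 2 / (99 / 5 - 5 * th)))))%:E)%E.
Proof.
move=> s0 q2 th0 th1 mG EG; set q := s ^+ 2 in q2 EG *.
have q0 : 0 < q by rewrite /q exprn_gt0.
have nR0 : 0 < n%:R :> R by rewrite ltr0n.
pose M := 2 * q - q ^+ 2 / 2.
have M0 : 0 < M.
  have -> : M = q * (2 - q / 2) by rewrite /M; ring.
  by rewrite mulr_gt0//; lra.
have [c [c0 c1 hc]] := variance_range_bound (ltW q0) q2.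
rewrite -/M in hc.
pose s2 := c ^+ 2 + (146 / 25 - 81 / 25 * c) * q.
pose b := 2 + M / 2; pose B := 2 + M.
pose Z (x : n.-tuple T) := n%:R * local_sup mu P0 F p0 s x.
have bL : bmeas (fun x : n.-tuple T => local_sup mu P0 F p0 s x).
  by split => //; exists 4 => x; exact: (local_sup_norm P0 hF hp0 hn x (ltW s0)).
have bZ : bmeas Z by rewrite /Z; bmeas_tac.
have G0 := ratio_class_nonempty mu P0 hp0 (ltW s0).
have s20 : 0 <= s2.
  by rewrite /s2 addr_ge0 ?sqr_ge0// mulr_ge0// ?ltW//; lra.
have EZ : \int[sample_distribution X]_x Z x =
  n%:R * \int[sample_distribution X]_x local_sup mu P0 F p0 s x.
  by rewrite /Z meanZ.
have EZ0 : 0 <= \int[sample_distribution X]_x Z x.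
  apply: mean_ge => // x.
  have Gp0 : ratio_class mu F P0 p0 s (centered_ratio P0 p0 p0).
    exists p0 => //; split => //; rewrite hellinger_le ?ltW//.
    rewrite /hellinger_sq; under eq_Rintegral do rewrite subrr expr0n.
    by rewrite Rintegral_cst// mul0r.
  apply: le_trans (local_sup_ub hF hp0 hn x (ltW s0) Gp0).
  apply: sumr_ge0 => i _; rewrite /centered_ratio subr_ge0.
  apply: (@le_trans _ _ 2).
    rewrite /likelihood_ratio; set y := tnth x i.
    have [_ p0_ge0 _] := dF hp0; have y0 := p0_ge0 y.
    have [->|yn0] := eqVneq (p0 y) 0; first by rewrite mulr0 mul0r.
    rewrite le_eqVlt; apply/orP; left; apply/eqP; field.
    by rewrite -mulr2n mulrn_eq0 negb_or/=.
  apply: le_trans (mean_ratio_ge (dF hp0) (dF hp0) hP0).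
  by rewrite lerDl hellinger_sq_ge0.
have hm p : F p -> hellinger mu p0 p <= s -> hellinger_sq mu p0 p <= q.
  by move=> Fp; rewrite hellinger_le// ltW.
have Gb g : ratio_class mu F P0 p0 s g -> bmeas g.
  by move=> [p [Fp _] <-]; exact: (bmeas_centered_ratio P0 hF hp0 Fp).
have Gm g : ratio_class mu F P0 p0 s g -> \int[P0]_y g y = 0.
  by move=> [p [Fp _] <-]; exact: (mean_centered_ratio P0 hF hp0 Fp).
have Gv g : ratio_class mu F P0 p0 s g -> \int[P0]_y (g y ^+ 2) <= s2.
  move=> [p [Fp hp] <-].
  exact: (mean_ratio_variance (dF hp0) (dF Fp) hP0 (hm p Fp hp) c0 c1).
have GB g y : ratio_class mu F P0 p0 s g -> g y <= B.
  move=> [p [Fp hp] <-]; rewrite /centered_ratio.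
  have := mean_ratio_le (dF hp0) (dF Fp) hP0 (hm p Fp hp) q2.
  have := likelihood_ratio_ge0 (dF hp0) (dF Fp) y.
  by rewrite /B /M; lra.
have Zub g x : ratio_class mu F P0 p0 s g -> \sum_(i < n) g (tnth x i) <= Z x.
  by move=> Gg; exact: (local_sup_ub hF hp0 hn x (ltW s0) Gg).
have Zap x e : 0 < e ->
    exists2 g, ratio_class mu F P0 p0 s g & Z x - e < \sum_(i < n) g (tnth x i).
  by move=> e0; exact: (local_sup_approx P0 hF hp0 hn x (ltW s0) e0).
have b0 : 0 < b by rewrite /b; lra.
have bB : b <= B by rewrite /b /B; lra.
have B2b : B < 2 * b by rewrite /b /B; lra.
have BbE : B - b = M / 2 by rewrite /b /B; field.
have K0 : 0 < s2 + (B - b) ^+ 2.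
  by rewrite BbE ltr_wpDl// exprn_gt0// divr_gt0.
have U0 : 0 < n%:R * (q * th) by rewrite !mulr_gt0.
have EZU : \int[sample_distribution X]_x Z x <= n%:R * q - n%:R * (q * th).
  rewrite EZ -mulrBr ler_pM2l//; apply: le_trans EG _.
  by rewrite le_eqVlt; apply/orP; left; apply/eqP; ring.
have := supremum_tail (sample_product_law hX) hn G0 Gb Gm Gv GB bZ Zub Zap
  b0 bB B2b K0 U0 EZ0 EZU.
move=> H; apply: (le_trans H); rewrite lee_fin ler_expR lerN2.
set W := (X in _ <= _ / X).
have W0 : 0 < W.
  have h1 : 0 < 2 * n%:R * (s2 + (B - b) ^+ 2) by rewrite mulr_gt0// mulr_gt0.
  have h2 : 0 <= b * (n%:R * (q * (1 - th))).
    by rewrite mulr_ge0 ?(ltW b0)// mulr_ge0 ?(ltW nR0)// mulr_ge0 ?(ltW q0)// subr_ge0.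
  have h3 : 0 < b * (n%:R * (q * th)) by rewrite mulr_gt0.
  by rewrite /W; lra.
have D0 : 0 < 99 / 5 - 5 * th by lra.
have WD : W <= n%:R * (q * (99 / 5 - 5 * th)).
  have -> : W = n%:R * (2 * (s2 + (M / 2) ^+ 2) + 4 * b * q - 5 / 2 * b * (q * th)).
    by rewrite /W BbE; field.
  rewrite ler_pM2l//.
  have h1 : 2 * (s2 + (M / 2) ^+ 2) + 4 * b * q <= 99 / 5 * q by exact: hc.
  have h2 : 0 <= M * (q * th) by rewrite !mulr_ge0// ltW.
  have h3 : 5 / 2 * b * (q * th) = 5 * (q * th) + 5 / 4 * (M * (q * th)).
    by rewrite /b; field.
  rewrite h3; lra.
have -> : n%:R * q * (th ^+ 2 / (99 / 5 - 5 * th)) =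
   (n%:R * (q * th)) ^+ 2 / (n%:R * (q * (99 / 5 - 5 * th))).
  move: (99 / 5 - 5 * th) D0 => D D0.
  by field; rewrite (gt_eqF D0) (gt_eqF q0) (gt_eqF nR0).
rewrite ler_wpM2l ?sqr_ge0// lef_pV2// posrE// !mulr_gt0//.
Qed.

Variables (t0 eta : R) (Gbar : R -> R).
Hypotheses (ht0 : 0 < t0) (heta0 : 0 < eta) (heta1 : eta <= 1).
Hypothesis mG : forall t : R, t0 <= t ->
  measurable_fun [set: n.-tuple T] (fun x : n.-tuple T => local_sup mu P0 F p0 t x).
Hypothesis hG1 : forall t : R, t0 <= t ->
  ('E_Pr[fun w : Omega => local_sup mu P0 F p0 t (sample X w)] <= (Gbar t)%:E)%E.
Hypothesis hG2 : Gbar t0 <= t0 ^+ 2.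
Hypothesis hG3 : forall s t : R, t0 <= s -> s <= t ->
  Gbar t / t `^ (2 - eta) <= Gbar s / s `^ (2 - eta).

(** The monotone quotient at [s] is at most its value at [t0]. *)
Lemma envelope_growth (s : R) : t0 <= s ->
  Gbar s <= s ^+ 2 * (t0 / s) `^ eta.
Proof.
move=> ts; have h0 := ht0; have s0 : 0 < s by exact: lt_le_trans ts.
have := hG3 (lexx t0) ts.
have pw u : 0 < u -> u `^ (2 - eta) = u ^+ 2 / u `^ eta.
  move=> u0; rewrite powRB ?powR_mulrn ?ltW//.
  by apply/implyP => _; rewrite gt_eqF.
have ts0 := powR_gt0 eta ht0; have ss0 := powR_gt0 eta s0.
rewrite !pw// ler_pdivrMr ?divr_gt0 ?exprn_gt0// => H; apply: (le_trans H).
have -> : (t0 / s) `^ eta = t0 `^ eta / s `^ eta.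
  by rewrite powRM ?invr_ge0 ?ltW// -powR_inv1 ?ltW// -powRrM mulN1r powRN.
have -> : Gbar t0 / (t0 ^+ 2 / t0 `^ eta) * (s ^+ 2 / s `^ eta) =
    (Gbar t0 / t0 ^+ 2) * (s ^+ 2 * (t0 `^ eta / s `^ eta)).
  by field; rewrite !gt_eqF.
rewrite -[leRHS]mul1r ler_wpM2r//.
  by rewrite mulr_ge0 ?sqr_ge0// divr_ge0// ltW.
by rewrite ler_pdivrMr ?exprn_gt0// mul1r.
Qed.

(** For [s = t0 + x], a radius with [s^2 > 2] is never exceeded. Otherwise
[local_sup_tail] applies with [th = 1 - (t0 / s)^eta], which is of order
[eta x / s]. *)
Lemma hellinger_tail (x : R) : 0 < x ->
  (Pr [set w | (t0 + x <= hellinger mu (phat w) p0)%R] <=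
   (expR (- (n%:R * eta ^+ 2 * x ^+ 2 / (99 / 5 - 5 * (x / (t0 + x))))))%:E)%E.
Proof.
move=> x0; have h0 := ht0; set s := t0 + x.
have ts : t0 <= s by rewrite /s; lra.
have s0 : 0 < s by exact: lt_le_trans ts.
have [q2|q2] := leP (s ^+ 2) 2; last first.
  rewrite (_ : [set w | _] = set0) ?measure0 ?lee_fin ?expR_ge0//.
  apply/seteqP; split => w //=; have [Fw _] := hphat w.
  have hs := hellinger_sq_le2 (dF Fw) (dF hp0).
  rewrite leNgt => /negP; apply.
  rewrite -ltr_sqr ?nnegrE ?hellinger_ge0 ?ltW// sqr_hellinger.
  exact: le_lt_trans q2.
pose y := x / s; have y0 : 0 < y by rewrite divr_gt0.
have y1 : y < 1 by rewrite /y ltr_pdivrMr// mul1r /s; lra.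
have zE : t0 / s = 1 - y.
  by rewrite /y /s; field; rewrite gt_eqF.
have z0 : 0 < t0 / s by rewrite divr_gt0.
pose th := 1 - (t0 / s) `^ eta.
have hth : eta * y * (1 + (1 - eta) * y / 4) <= th.
  have := powR_le_bernoulli2 z0 _ (ltW heta0) heta1.
  rewrite /th zE; have -> : 1 - (1 - y) = y by ring.
  by apply; lra.
have th1 : th <= 1 by rewrite /th; have := powR_ge0 (t0 / s) eta; lra.
have th0 : 0 < th.
  apply: lt_le_trans hth; apply: mulr_gt0; first exact: mulr_gt0.
  by rewrite ltr_wpDr// divr_ge0// mulr_ge0 ?(ltW y0)// subr_ge0.
apply: (le_trans (mle_tail_local_sup s0 (mG ts))).
have EG : \int[sample_distribution X]_z local_sup mu P0 F p0 s z <= s ^+ 2 * (1 - th).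
  have bL : bmeas (fun x : n.-tuple T => local_sup mu P0 F p0 s x).
    split; first exact: mG.
    by exists 4 => z; exact: (local_sup_norm P0 hF hp0 hn z (ltW s0)).
  have := hG1 ts; rewrite (mean_sample X bL) lee_fin => H.
  apply: (le_trans H); apply: (le_trans (envelope_growth ts)).
  by rewrite /th opprB addrC subrK.
apply: (le_trans (local_sup_tail s0 q2 th0 th1 (mG ts) EG)).
rewrite lee_fin ler_expR lerN2.
have := exponent_comparison heta0 heta1 (ltW y0) y1 hth th1.
rewrite -/y => H.
have -> : n%:R * eta ^+ 2 * x ^+ 2 / (99 / 5 - 5 * y) =
   n%:R * s ^+ 2 * ((eta * y) ^+ 2 / (99 / 5 - 5 * y)).
  have xE : x = s * y by rewrite /y mulrC divfK// gt_eqF.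
  rewrite [in LHS]xE; ring.
by rewrite ler_wpM2l// mulr_ge0// ?sqr_ge0.
Qed.

End mle_tail.

(** * Layer-cake bound for the second moment *)

Section layer_cake.
Context {R : realType}.
Notation mu := (@lebesgue_measure R).

Lemma integral_derive (f df : R -> R) (a b : R) : a <= b ->
  (forall x : R, is_derive x 1 f (df x)) -> continuous df ->
  (\int[mu]_(x in `[a, b]) (df x)%:E)%E = (f b - f a)%:E.
Proof.
move=> ab fdf cdf; move: ab; rewrite le_eqVlt => /predU1P[<-|ab].
  by rewrite set_itv1 integral_set1 subrr.
have cf : continuous f.
  move=> x; apply: differentiable_continuous; apply/derivable1_diffP.
  exact: ex_derive.
rewrite (@continuous_FTC2 R df f) ?EFinB//.
- exact: continuous_subspaceT.
- split.
  + by move=> x _; exact: ex_derive.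
  + by apply: cvg_at_right_filter; exact: cf.
  + by apply: cvg_at_left_filter; exact: cf.
- by move=> x _; rewrite derive1E (@derive_val _ _ _ _ _ _ _ (fdf x)).
Qed.

Lemma derivable_continuous (f df : R -> R) :
  (forall x : R, is_derive x 1 f (df x)) -> continuous f.
Proof.
move=> fdf x; apply: differentiable_continuous; apply/derivable1_diffP.
exact: ex_derive.
Qed.

Context {d} {Omega : measurableType d}.
Variable Pr : probability Omega R.

(** Above [t], the square [H^2] exceeds [t^2] by the integral of [2 (t + x)] over the
[x] with [t + x <= H]; Tonelli's theorem exchanges this integral with the mean. *)
Lemma second_moment_layer_cake (H : Omega -> R) (t A : R) :
  measurable_fun [set: Omega] H -> (forall w, 0 <= H w) -> 0 < t -> 0 <= A ->
  (forall w, H w <= t + A) ->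
  (\int[Pr]_w ((H w) ^+ 2)%:E <= (t ^+ 2)%:E +
    \int[mu]_(x in `[0%R, A]) ((2 * (t + x))%:E *
       Pr [set w | (t + x <= H w)%R]))%E.
Proof.
move=> mH H0 t0 A0 HA.
pose GR := measurableTypeR R.
pose S : set (Omega * GR) :=
  [set p | [&& 0 <= p.2 :> R, (p.2 : R) <= A & t + (p.2 : R) <= H p.1]].
have m2 : measurable_fun [set: Omega * GR] (fun p => p.2 : R).
  exact: measurable_snd.
have mS : measurable S.
  have m1 : measurable_fun [set: Omega * GR] (fun p => 0 <= p.2 :> R).
    by apply: measurable_fun_ler.
  have m3 : measurable_fun [set: Omega * GR] (fun p => p.2 <= A :> R).
    by apply: measurable_fun_ler.
  have m4 : measurable_fun [set: Omega * GR] (fun p => t + p.2 <= H p.1 :> R).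
    apply: measurable_fun_ler; first exact: measurable_realfun.measurable_funD.
    exact: measurableT_comp measurable_fst.
  have := measurable_and m1 (measurable_and m3 m4).
  by move=> /(_ measurableT [set true]); rewrite setTI; exact.
pose f (p : Omega * GR) : \bar R := (2 * (t + (p.2 : R)) * \1_S p)%:E.
have f0 p : (0 <= f p)%E.
  rewrite /f lee_fin indicE; have [|_] := boolP (p \in S); last by rewrite mulr0.
  by rewrite inE => /and3P[p0 _ _]; rewrite mulr1 mulr_ge0// addr_ge0// ltW.
have mf : measurable_fun [set: Omega * GR] f.
  apply/measurable_EFinP; apply: measurable_realfun.measurable_funM.
    apply: measurable_realfun.measurable_funM => //.
    exact: measurable_realfun.measurable_funD.
  exact: measurable_indic.
apply: (@le_trans _ _ (\int[Pr]_w ((t ^+ 2)%:E + \int[mu]_x f (w, x)))%E).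
  apply: ge0_le_integral => //.
  - by move=> w _; rewrite lee_fin sqr_ge0.
  - by apply/measurable_EFinP; exact: measurable_funX.
  - have := @measurable_fun_fubini_tonelli_F _ _ _ _ R mu f mf f0.
    exact: emeasurable_funD.
  - move=> w _.
    have I0 : (0 <= \int[mu]_x f (w, x))%E by exact: integral_ge0.
    (* only the part of the integral up to [H w - t] counts *)
    have [hw|hw] := leP (H w) t.
      apply: (@le_trans _ _ (t ^+ 2)%:E).
        by rewrite lee_fin ler_sqr ?nnegrE// ltW.
      by rewrite leeDl.
    have h0 : 0 <= H w - t by rewrite subr_ge0 ltW.
    have hA : H w - t <= A by rewrite lerBlDl.
    apply: (@le_trans _ _ ((t ^+ 2)%:E +
        \int[mu]_(x in `[0%R, (H w - t)%R]) f (w, x))%E); last first.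
      rewrite leeD2l// ge0_subset_integral//.
      exact: (measurableT_comp mf (pair1_measurable w)).
    rewrite (_ : \int[mu]_(x in _) _ = ((t + (H w - t)) ^+ 2 - (t + 0) ^+ 2)%:E)%E.
      by rewrite -EFinD lee_fin; lra.
    pose g (x : R) := (t + x) ^+ 2; pose dg (x : R) := 2 * (t + x).
    have gdg (x : R) : is_derive x 1 g (dg x).
      by rewrite /g; apply: is_derive_eq; rewrite /dg /GRing.scale/=; ring.
    have cdg : continuous dg.
      apply: (@derivable_continuous _ (fun=> 2)) => x; rewrite /dg.
      by apply: is_derive_eq; rewrite /GRing.scale/=; ring.
    rewrite -/(g (H w - t)) -/(g 0) -(integral_derive h0 gdg cdg).
    apply: eq_integral => x; rewrite inE/= in_itv/= => /andP[x0 xh].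
    rewrite /f/= indicE mem_set ?mulr1// /S/= x0 (le_trans xh hA)/=.
    by move: xh; rewrite lerBrDl.
rewrite ge0_integralD//; first last.
- exact: (@measurable_fun_fubini_tonelli_F _ _ _ _ R mu f mf f0).
- by move=> w _; exact: integral_ge0.
- by move=> w _; rewrite lee_fin sqr_ge0.
rewrite integral_cst// [X in (_ * X)%E]probability_setT mule1 leeD2l//.
rewrite (@fubini_tonelli _ _ _ _ R Pr mu f)//.
rewrite [leRHS]integral_mkcond le_eqVlt; apply/orP; left; apply/eqP.
apply: eq_integral => x _.
rewrite patchE; case: ifPn => [|xA].
  rewrite inE/= in_itv/= => /andP[x0 xA].
  have mE : measurable [set w | t + x <= H w] by exact: measurable_ge.
  transitivity (\int[Pr]_w ((2 * (t + x))%:E * (\1_[set w | t + x <= H w] w)%:E))%E.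
    apply: eq_integral => w _; rewrite /f/= EFinM; congr (_ * _%:E)%E.
    rewrite !indicE; suff -> : ((w, x) \in S) = (w \in [set w | t + x <= H w]) by [].
    by apply/idP/idP; rewrite !inE /S/= x0 xA.
  rewrite ge0_integralZl//.
  - by rewrite integral_indic// setIT.
  - exact/measurable_EFinP/measurable_indic.
  - by rewrite lee_fin mulr_ge0// addr_ge0// ltW.
rewrite integral0_eq// => w _; rewrite /f/= indicE memNset ?mulr0//.
rewrite /S/= => /and3P[x0 x1 _]; move: xA; rewrite notin_setE/= in_itv/=.
by rewrite x0 x1.
Qed.
End layer_cake.

(** * Gaussian integrals *)

Section gaussian_tail.
Context {R : realType}.
Notation mu := (@lebesgue_measure R).

Lemma sin_ge_cubic (x : R) : 0 <= x -> x - x ^+ 3 / 6 <= sin x.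
Proof.
have sin_le (y : R) : 0 <= y -> sin y <= y.
  move=> y0; rewrite -subr_ge0; pose g (t : R) := t - sin t.
  have g0 : g 0 = 0 by rewrite /g sin0 subr0.
  rewrite -[X in X <= _]g0 -[X in _ <= X]/(g y).
  apply: (@le_of_derive_ge0 _ g (fun t => 1 - cos t)) y0.
  by move=> t _; rewrite subr_ge0 cos_le1.
have cos_ge (y : R) : 0 <= y -> 1 - y ^+ 2 / 2 <= cos y.
  move=> y0; rewrite -subr_ge0; pose g (t : R) := cos t - (1 - t ^+ 2 / 2).
  have g0 : g 0 = 0 by rewrite /g cos0; ring.
  rewrite -[X in X <= _]g0 -[X in _ <= X]/(g y).
  apply: (@le_of_derive_ge0 _ g (fun t => t - sin t)) y0.
    move=> t; have q : is_derive t 1 (fun t : R => 1 - t ^+ 2 / 2) (- t).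
      by apply: is_derive_eq; rewrite /GRing.scale/=; field.
    have h := is_deriveB (is_derive_cos t) q.
    by apply: (@is_derive_eq _ _ _ _ _ _ _ _ h); ring.
  by move=> t /ltW t0; rewrite subr_ge0 sin_le.
move=> x0; rewrite -subr_ge0; pose g (t : R) := sin t - (t - t ^+ 3 / 6).
have g0 : g 0 = 0 by rewrite /g sin0; ring.
rewrite -[X in X <= _]g0 -[X in _ <= X]/(g x).
apply: (@le_of_derive_ge0 _ g (fun t => cos t - (1 - t ^+ 2 / 2))) x0.
  move=> t; have q : is_derive t 1 (fun t : R => t - t ^+ 3 / 6) (1 - t ^+ 2 / 2).
    by apply: is_derive_eq; rewrite /GRing.scale/=; field.
  have h := is_deriveB (is_derive_sin t) q; exact: h.
by move=> t /ltW t0; rewrite subr_ge0 cos_ge.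
Qed.

(** The cosine is negative at 8/5, because the sine is large enough at 4/5. *)
Lemma pi_le : pi <= 16 / 5 :> R.
Proof.
rewrite leNgt; apply/negP => h.
have h1 : 0 < cos (8 / 5 : R) by apply: cos_gt0_pihalf; apply/andP; split; lra.
have h2 : 4 / 5 - (4 / 5) ^+ 3 / 6 <= sin (4 / 5 : R) by apply: sin_ge_cubic; lra.
have e : cos (8 / 5 : R) = 1 - 2 * sin (4 / 5) ^+ 2.
  rewrite (_ : 8 / 5 = (4 / 5) *+ 2); last by field.
  by rewrite cos_mulr2n cos2sin2; ring.
have : (4 / 5 - (4 / 5) ^+ 3 / 6) ^+ 2 <= sin (4 / 5 : R) ^+ 2.
  by rewrite ler_sqr ?nnegrE//; lra.
lra.
Qed.

(** With [k = 25/99], that is 5 divided by 99/5, the exponent is at least [x^2 + w] for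
[w = k x^3 / (t + x)], and [exp (-w) <= 1 - w + w^2 / 2]. Multiplied by
[2 (t + x)], the term [- w] becomes [- 2 k x^3]: a gain that does not depend
on [t]. *)
Lemma tail_le_gaussian (t x : R) : 0 < t -> 0 <= x ->
  2 * (t + x) * expR (- (x ^+ 2 / (1 - 25 / 99 * (x / (t + x))))) <=
  2 * t * expR (- x ^+ 2) +
  (2 * x - 2 * (25 / 99) * x ^+ 3 + (25 / 99) ^+ 2 * x ^+ 5) * expR (- x ^+ 2).
Proof.
move=> t0 x0; set k : R := 25 / 99.
have k0 : 0 < k by rewrite /k; lra.
have tx : 0 < t + x by lra.
set y := x / (t + x); have y0 : 0 <= y by rewrite divr_ge0// ltW.
have y1 : y <= 1 by rewrite ler_pdivrMr// mul1r; lra.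
have ky : k * y < 1 by rewrite /k; lra.
pose w := x ^+ 2 * (k * y).
have w0 : 0 <= w by rewrite mulr_ge0 ?sqr_ge0// mulr_ge0// ltW.
have h1 : expR (- (x ^+ 2 / (1 - k * y))) <= expR (- x ^+ 2) * expR (- w).
  rewrite -expRD ler_expR -opprD lerN2 /w -[X in X + _]mulr1 -mulrDr.
  rewrite ler_wpM2l ?sqr_ge0// -[leRHS]mul1r ler_pdivlMr ?subr_gt0//.
  have : 0 <= (k * y) ^+ 2 by exact: sqr_ge0.
  lra.
have h2 : expR (- w) <= 1 - w + w ^+ 2 / 2.
  rewrite expRN -[leLHS]mul1r ler_pdivrMr ?expR_gt0//.
  have q0 : 0 < 1 - w + w ^+ 2 / 2 by have := sqr_ge0 (w - 1); lra.
  apply: le_trans (_ : (1 - w + w ^+ 2 / 2) * (1 + w + w ^+ 2 / 2) <= _).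
    have : 0 <= w ^+ 4 by rewrite exprn_ge0.
    lra.
  by rewrite ler_pM2l// expR_ge_quadratic.
have e0 : 0 <= expR (- x ^+ 2) by exact: expR_ge0.
apply: le_trans (_ : 2 * (t + x) * (expR (- x ^+ 2) * (1 - w + w ^+ 2 / 2)) <= _).
  rewrite ler_wpM2l ?mulr_ge0 ?(ltW tx)//.
  by apply: (le_trans h1); rewrite ler_wpM2l.
rewrite -mulrDl mulrCA mulrC ler_wpM2r//.
have wE : w * (t + x) = k * x ^+ 3 by rewrite /w /y; field; rewrite gt_eqF.
have wxE : w <= k * x ^+ 2.
  by rewrite /w mulrC ler_wpM2r ?sqr_ge0// -[leRHS]mulr1 ler_pM2l.
have : k * x ^+ 3 * w <= k * x ^+ 3 * (k * x ^+ 2).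
  by rewrite ler_wpM2l// mulr_ge0 ?exprn_ge0// ltW.
have -> : 2 * (t + x) * (1 - w + w ^+ 2 / 2) = 2 * (t + x) - 2 * (w * (t + x)) + (w * (t + x)) * w by field.
rewrite wE; lra.
Qed.

Lemma gaussian_integral_le (A : R) : 0 <= A ->
  (\int[mu]_(x in `[0%R, A]) (expR (- x ^+ 2))%:E <= (Num.sqrt pi / 2)%:E)%E.
Proof.
move=> A0; rewrite -integral0y_gauss.
apply: ge0_subset_integral => //.
- apply/measurable_EFinP; apply: measurable_funTS.
  apply: continuous_measurable_fun; exact: continuous_gauss_fun.
- exact: subset_itvl.
Qed.

(** The antiderivative is explicit; at [0] it is [- (1 - k + k^2)], and it stays
nonpositive. *)
Lemma polynomial_gaussian_integral_le (k A : R) : 0 <= A ->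
  (\int[mu]_(x in `[0%R, A])
     ((2 * x - 2 * k * x ^+ 3 + k ^+ 2 * x ^+ 5) * expR (- x ^+ 2))%:E <=
   (1 - k + k ^+ 2)%:E)%E.
Proof.
move=> A0.
pose g (x : R) := - ((1 - k * (1 + x ^+ 2) +
  k ^+ 2 / 2 * (x ^+ 4 + 2 * x ^+ 2 + 2)) * expR (- x ^+ 2)).
pose dg (x : R) := (2 * x - 2 * k * x ^+ 3 + k ^+ 2 * x ^+ 5) * expR (- x ^+ 2).
have gdg (x : R) : is_derive x 1 g (dg x).
  by rewrite /g; apply: is_derive_eq; rewrite /dg /GRing.scale/=; field.
have cdg : continuous dg.
  move=> x; apply: differentiable_continuous; apply/derivable1_diffP.
  by rewrite /dg; apply: ex_derive.
rewrite -/(dg _) (integral_derive A0 gdg cdg) lee_fin /g.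
rewrite !expr0n/= oppr0 expR0.
suff : 0 <= (1 - k * (1 + A ^+ 2) + k ^+ 2 / 2 * (A ^+ 4 + 2 * A ^+ 2 + 2)) * expR (- A ^+ 2) by lra.
rewrite mulr_ge0 ?expR_ge0//.
have := sqr_ge0 (k * (1 + A ^+ 2) - 1); have := sqr_ge0 k; lra.
Qed.

End gaussian_tail.

(** * From the tail to the second moment *)

Section second_moment.
Context {R : realType} {d} {Omega : measurableType d}.
Variable Pr : probability Omega R.
Notation mu := (@lebesgue_measure R).

(** By [tail_le_gaussian] the tail contributes at most [t sqrt pi + 1 - k + k^2], and
[t sqrt pi <= t^2 + pi / 4]. The constants add up to less than 160/99 because
[pi <= 16/5]. *)
Lemma second_moment_le (H : Omega -> R) (t A : R) :
  measurable_fun [set: Omega] H -> (forall w, 0 <= H w) -> 0 < t -> 0 <= A ->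
  (forall w, H w <= t + A) ->
  (forall x : R, 0 < x -> (Pr [set w | (t + x <= H w)%R] <=
     (expR (- (x ^+ 2 / (1 - 25 / 99 * (x / (t + x))))))%:E)%E) ->
  (\int[Pr]_w ((H w) ^+ 2)%:E <= (2 * t ^+ 2 + 160 / 99)%:E)%E.
Proof.
move=> mH H0 t0 A0 HA tail.
have mE (x : R) : measurable [set w | t + x <= H w] by exact: measurable_ge.
apply: (le_trans (second_moment_layer_cake Pr mH H0 t0 A0 HA)).
pose k : R := 25 / 99.
pose f1 (x : R) := 2 * t * expR (- x ^+ 2).
pose f2 (x : R) := (2 * x - 2 * k * x ^+ 3 + k ^+ 2 * x ^+ 5) * expR (- x ^+ 2).
have cf1 : continuous f1.
  move=> x; apply: differentiable_continuous; apply/derivable1_diffP.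
  by rewrite /f1; apply: ex_derive.
have cf2 : continuous f2.
  move=> x; apply: differentiable_continuous; apply/derivable1_diffP.
  by rewrite /f2; apply: ex_derive.
have mf1 : measurable_fun `[0, A] (EFin \o f1).
  apply/measurable_EFinP; apply: measurable_funTS.
  exact: continuous_measurable_fun.
have mf2 : measurable_fun `[0, A] (EFin \o f2).
  apply/measurable_EFinP; apply: measurable_funTS.
  exact: continuous_measurable_fun.
have f10 (x : R) : 0 <= f1 x by rewrite !mulr_ge0 ?expR_ge0// ltW.
have f20 (x : R) : 0 <= x -> 0 <= f2 x.
  move=> x0; rewrite mulr_ge0 ?expR_ge0//.
  have -> : 2 * x - 2 * k * x ^+ 3 + k ^+ 2 * x ^+ 5 =
    x * ((k * x ^+ 2 - 1) ^+ 2 + 1) by ring.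
  by rewrite mulr_ge0// addr_ge0// sqr_ge0.
have P1 (x : R) : 0 <= x -> (Pr [set w | (t + x <= H w)%R] <=
    (expR (- (x ^+ 2 / (1 - k * (x / (t + x))))))%:E)%E.
  rewrite le_eqVlt => /predU1P[<-|]; last exact: tail.
  by rewrite expr0n/= mul0r oppr0 expR0 probability_le1.
have step : (\int[mu]_(x in `[0%R, A]) ((2 * (t + x))%:E *
      Pr [set w | (t + x <= H w)%R]) <=
    \int[mu]_(x in `[0%R, A]) ((f1 x)%:E + (f2 x)%:E))%E.
  apply: ge0_le_integral => //.
  - move=> x; rewrite /= in_itv/= => /andP[x0 _].
    by rewrite mule_ge0// lee_fin mulr_ge0// addr_ge0// ltW.
  - have -> : (fun x : R => ((2 * (t + x))%:E * Pr [set w | (t + x <= H w)%R])%E)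
        = EFin \o (fun x : R => 2 * (t + x) * fine (Pr [set w | t + x <= H w])).
      apply/funext => x /=; rewrite [RHS]EFinM fineK//.
      exact: fin_num_measure.
    apply/measurable_EFinP; apply: measurable_funTS.
    apply: measurable_realfun.measurable_funM.
      apply: measurable_realfun.measurable_funM => //.
      exact: measurable_realfun.measurable_funD.
    apply: nonincreasing_measurable => // x y xy.
    rewrite fine_le ?fin_num_measure// le_measure ?inE// => w /=.
    by apply: le_trans; rewrite lerD2l.
  - exact: emeasurable_funD.
  - move=> x; rewrite /= in_itv/= => /andP[x0 _].
    apply: (@le_trans _ _ ((2 * (t + x))%:E *
       (expR (- (x ^+ 2 / (1 - k * (x / (t + x))))))%:E)%E).
      by rewrite lee_wpmul2l ?P1// lee_fin mulr_ge0// addr_ge0// ltW.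
    by rewrite -EFinM -EFinD lee_fin; exact: tail_le_gaussian.
apply: (le_trans (leeD2l _ step)).
rewrite ge0_integralD//; first last.
- by move=> x; rewrite /= in_itv/= => /andP[x0 _]; rewrite lee_fin f20.
- by move=> x _; rewrite lee_fin.
have i2 := polynomial_gaussian_integral_le k A0.
have i1 : (\int[mu]_(x in `[0%R, A]) (f1 x)%:E <= (2 * t * (Num.sqrt pi / 2))%:E)%E.
  under eq_integral do rewrite /f1 EFinM.
  rewrite ge0_integralZl//.
  - rewrite [leRHS]EFinM lee_wpmul2l//; last exact: gaussian_integral_le.
    by rewrite lee_fin mulr_ge0// ltW.
  - apply/measurable_EFinP; apply: measurable_funTS.
    apply: continuous_measurable_fun; exact: continuous_gauss_fun.
  - by rewrite lee_fin mulr_ge0// ltW.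
apply: (le_trans (leeD2l _ (leeD i1 i2))); rewrite -!EFinD lee_fin.
set s := Num.sqrt pi; have sE : s ^+ 2 = pi by rewrite sqr_sqrtr ?pi_ge0.
have := @pi_le R; rewrite -sE => s1; have := sqr_ge0 (t - s / 2).
rewrite /k; lra.
Qed.

(** The factor [sqrt (N / (99/5))] normalizes the exponent, and 160/99 is 32 divided
by 99/5. *)
Lemma second_moment_le_scaled (h : Omega -> R) (t N : R) :
  measurable_fun [set: Omega] h -> (forall w, 0 <= h w) -> 0 < t -> 0 < N ->
  (exists A, forall w, h w <= A) ->
  (forall x : R, 0 < x -> (Pr [set w | (t + x <= h w)%R] <=
     (expR (- (N * x ^+ 2 / (99 / 5 - 5 * (x / (t + x))))))%:E)%E) ->
  (\int[Pr]_w ((h w) ^+ 2)%:E <= (2 * t ^+ 2 + 32 / N)%:E)%E.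
Proof.
move=> mh h0 t0 N0 [A hA] tail.
pose r := N / (99 / 5); have r0 : 0 < r by rewrite divr_gt0//; lra.
pose q := Num.sqrt r; have q0 : 0 < q by rewrite sqrtr_gt0.
have qE : q ^+ 2 = r by rewrite sqr_sqrtr ?ltW.
have mH : measurable_fun [set: Omega] (fun w => q * h w).
  exact: measurable_realfun.measurable_funM.
have := @second_moment_le (fun w => q * h w) (q * t) (q * `|A|) mH.
have -> : (\int[Pr]_w ((q * h w) ^+ 2)%:E =
           r%:E * \int[Pr]_w ((h w) ^+ 2)%:E)%E.
  rewrite -ge0_integralZl//.
  - by apply: eq_integral => w _; rewrite exprMn qE EFinM.
  - by apply/measurable_EFinP; exact: measurable_funX.
  - by move=> w _; rewrite lee_fin sqr_ge0.
  - by rewrite lee_fin ltW.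
have -> : 2 * (q * t) ^+ 2 + 160 / 99 = r * (2 * t ^+ 2 + 32 / N).
  by rewrite exprMn qE /r; field; rewrite gt_eqF.
rewrite (EFinM r (2 * t ^+ 2 + 32 / N)) lee_pmul2l//; apply.
- by move=> w; rewrite mulr_ge0// ltW.
- by rewrite mulr_gt0.
- by rewrite mulr_ge0// ltW.
- move=> w; rewrite -mulrDr ler_pM2l// (le_trans (hA w))//.
  by rewrite (le_trans (ler_norm A))// lerDr ltW.
- move=> x x0; have := tail (x / q) (divr_gt0 x0 q0).
  rewrite (_ : [set w | _] = [set w | (q * t + x <= q * h w)%R]); last first.
    apply/funext => w /=; congr (is_true _).
    have -> : q * t + x = q * (t + x / q) by field; rewrite gt_eqF.
    by rewrite ler_pM2l.
  move=> hx; apply: (le_trans hx); rewrite lee_fin ler_expR lerN2.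
  have tx : 0 < q * t + x by rewrite addr_gt0// mulr_gt0.
  have -> : x / q / (t + x / q) = x / (q * t + x).
    field; rewrite !gt_eqF//.
  set y := x / (q * t + x).
  have y1 : y <= 1 by rewrite ler_pdivrMr// mul1r lerDr mulr_ge0// ltW.
  have yy : 0 < 1 - 25 / 99 * y by lra.
  rewrite expr_div_n qE /r le_eqVlt; apply/orP; left; apply/eqP.
  by field; rewrite ?gt_eqF//; lra.
Qed.

End second_moment.

(** * Maximum likelihood over a convex class *)

Theorem theorem2p1 (R : realType)
    (d : measure_display) (T : measurableType d)
    (mu : {measure set T -> \bar R})
    (F : set (T -> R)) (hF : convex_density_class mu F)
    (p0 : T -> R) (hp0 : F p0)
    (P0 : probability T R) (hP0 : has_density mu P0 p0)
    (d' : measure_display) (Omega : measurableType d')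
    (Pr : probability Omega R)
    (n : nat) (hn : (0 < n)%N)
    (X : 'I_n -> {RV Pr >-> T}) (hX : iid P0 X)
    (phat : Omega -> T -> R)
    (hphat : forall w : Omega, is_mle [tuple X i w | i < n] F (phat w))
    (mphat : measurable_fun [set: Omega] (fun w => hellinger mu (phat w) p0))
    (t0 eta : R) (Gbar : R -> R)
    (ht0 : 0 < t0) (heta0 : 0 < eta) (heta1 : eta <= 1)
    (hGbar : forall t : R, 0 <= t -> 0 <= Gbar t)
    (mG : forall t : R, t0 <= t ->
      measurable_fun [set: n.-tuple T]
        (fun x : n.-tuple T => local_sup mu P0 F p0 t x))
    (hG1 : forall t : R, t0 <= t ->
      ('E_Pr[fun w : Omega => local_sup mu P0 F p0 t [tuple X i w | i < n]]
        <= (Gbar t)%:E)%E)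
    (hG2 : Gbar t0 <= t0 ^+ 2)
    (hG3 : forall s t : R, t0 <= s -> s <= t ->
      Gbar t / t `^ (2 - eta) <= Gbar s / s `^ (2 - eta)) :
  (forall x : R, 0 < x ->
     (Pr [set w : Omega | (t0 + x <= hellinger mu (phat w) p0)%R]
       <= (expR (- (n%:R * eta ^+ 2 * x ^+ 2) / 32))%:E)%E) /\
  ('E_Pr[fun w : Omega => (hellinger mu (phat w) p0 ^+ 2)%R]
     <= (2 * t0 ^+ 2 + 32 / (n%:R * eta ^+ 2))%:E)%E.
Proof.
have [dF _] := hF.
have tail := hellinger_tail hF hp0 hP0 hn hX hphat mphat ht0 heta0 heta1 mG hG1
  hG2 hG3.
have N0 : 0 < n%:R * eta ^+ 2 by rewrite mulr_gt0 ?ltr0n// exprn_gt0.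
split=> [x x0|].
  apply: (le_trans (tail x x0)); rewrite lee_fin ler_expR mulNr lerN2.
  set y := x / (t0 + x).
  have tx : 0 < t0 + x by rewrite addr_gt0.
  have y0 : 0 <= y by rewrite divr_ge0// ltW.
  have y1 : y <= 1 by rewrite ler_pdivrMr// mul1r lerDr ltW.
  rewrite ler_wpM2l//; first by rewrite (mulr_ge0 (ltW N0)) ?sqr_ge0.
  by rewrite lef_pV2 ?posrE//; lra.
rewrite unlock; apply: (second_moment_le_scaled mphat) => //.
- by move=> w; exact: hellinger_ge0.
- exists 2 => w; have [Fw _] := hphat w.
  rewrite hellinger_le//; apply: le_trans (hellinger_sq_le2 (dF _ Fw) (dF _ hp0)) _.
  by lra.
Qed.
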